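(* Let $\lambda$ be a frequency containing arbitrarily large arithmetic progressions. Then the democracy and super-democracy functions of $\mathcal B=\{e^{-\lambda_n s}\}$ in $\mathcal H_p^\lambda$ satisfy: (a) $\varphi_l^{p,\lambda}(N)\approx\varphi_{l,\mathcal E}^{p,\lambda}(N)\approx\log(N)$ (for $N\ge2$) if $p=1$; $\varphi_l^{p,\lambda}(N)\approx\varphi_{l,\mathcal E}^{p,\lambda}(N)\approx N^{1/p'}$ if $1<p\le2$; and $\varphi_{l,\mathcal E}^{\infty,\lambda}(N)\approx N^{1/2}$. (b) $\varphi_u^{p,\lambda}(N)\approx\varphi_{u,\mathcal E}^{p,\lambda}(N)\approx N^{1/p'}$ if $2\le p<\infty$. As a consequence, all democracy and super-democracy functions grow as for ordinary Dirichlet series, that is: for $p=1$, $\varphi_l^{1,\lambda}(N)\approx\varphi_{l,\mathcal E}^{1,\lambda}(N)\approx\log(N)$ (for $N\ge 2$) and $\varphi_u^{1,\lambda}(N)\approx\varphi_{u,\mathcal E}^{1,\lambda}(N)\approx N^{1/2}$; for $1<p<\infty$, $\varphi_l^{p,\lambda}(N)\approx\varphi_{l,\mathcal E}^{p,\lambda}(N)\approx N^{\min\{1/2,1/p'\}}$ and $\varphi_u^{p,\lambda}(N)\approx\varphi_{u,\mathcal E}^{p,\lambda}(N)\approx N^{\max\{1/2,1/p'\}}$; for $p=\infty$, $\varphi_l^{\infty,\lambda}(N)=N$, $\varphi_{l,\mathcal E}^{\infty,\lambda}(N)\approx N^{1/2}$ and $\varphi_u^{\infty,\lambda}(N)=\varphi_{u,\mathcal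 E}^{\infty,\lambda}(N)=N$.
   Context: A frequency is a strictly increasing unbounded sequence $\lambda=(\lambda_n)_{n\ge1}$ of non-negative real numbers. It contains arbitrarily large arithmetic progressions if for every $N\in\mathbb N$ there are $a,b\in\mathbb R$ with $b>0$ such that $\{a+kb:k=1,\dots,N\}\subset\{\lambda_n:n\in\mathbb N\}$. A $\lambda$-Dirichlet polynomial is a finite sum $D=\sum_{n\in A}a_n e^{-\lambda_n s}$, with $A\subset\mathbb N$ finite and $a_n\in\mathbb C$. Its norms are $\|D\|_{\mathcal H_p^\lambda}=\lim_{R\to\infty}\big(\frac1{2R}\int_{-R}^R|\sum_{n\in A}a_n e^{-\lambda_n it}|^p\,dt\big)^{1/p}$ for $1\le p<\infty$ and $\|D\|_{\mathcal H_\infty^\lambda}=\sup_{t\in\mathbb R}|\sum_{n\in A}a_n e^{-i\lambda_n t}|$. For $1\le p<\infty$, $\mathcal H_p^\lambda$ is the completion of the space of $\lambda$-Dirichlet polynomials under $\|\cdot\|_{\mathcal H_p^\lambda}$; for $p=\infty$ only the norms of Dirichlet polynomials matter here. For a finite set $A\subset\mathbb N$ let $\mathcal E_A$ be the set of families $\varepsilon=(\varepsilon_n)_{n\in A}$ of complex numbers with $|\varepsilon_n|=1$. Put $\mathbf 1_{\varepsilon,A}=\sum_{n\in A}\varepsilon_n e^{-\lambda_n s}$ and $\mathbf 1_A=\sum_{n\in A}e^{-\lambda_n s}$. For $N\in\mathbb N$, with $A$ ranging over finite subsets of $\mathbb N$ and all norms taken in $\mathcal H_p^\lambda$: $\varphi_u^{p,\lambda}(N)=\sup\{\|\mathbf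 1_A\|:|A|\le N\}$, $\varphi_l^{p,\lambda}(N)=\inf\{\|\mathbf 1_A\|:|A|\ge N\}$, $\varphi_{u,\mathcal E}^{p,\lambda}(N)=\sup\{\|\mathbf 1_{\varepsilon,A}\|:|A|\le N,\ \varepsilon\in\mathcal E_A\}$, $\varphi_{l,\mathcal E}^{p,\lambda}(N)=\inf\{\|\mathbf 1_{\varepsilon,A}\|:|A|\ge N,\ \varepsilon\in\mathcal E_A\}$. $p'$ is the conjugate exponent, $\frac1p+\frac1{p'}=1$. $f(N)\approx g(N)$ means that there are constants $c,C>0$ independent of $N$ with $c\,g(N)\le f(N)\le C\,g(N)$ for all $N$ under consideration. *)

(* Defs.v *)
From HB Require Import structures.
From mathcomp Require Import all_boot all_order all_algebra finmap.
From mathcomp Require Import complex.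
From mathcomp Require Import all_classical all_reals all_analysis.

Set Implicit Arguments.
Unset Strict Implicit.
Unset Printing Implicit Defensive.

Import Order.TTheory GRing.Theory Num.Theory.
Import numFieldNormedType.Exports.

Local Open Scope classical_set_scope.
Local Open Scope ring_scope.
Local Open Scope complex_scope.

Section DirichletPolynomials.
Variable R : realType.
Implicit Types (lam : nat -> R) (A : {fset nat}) (a eps : nat -> R[i])
  (D : R[i] -> R[i]) (p : \bar R).

(* Indexing starts at 0: lam n stands for $\lambda_{n+1}$. *)
Definition is_frequency lam : Prop :=
  [/\ forall n, 0 <= lam n,
      forall m n, (m < n)%N -> lam m < lam n
    & forall M : R, exists n, M < lam n].

Definition has_large_APs lam : Prop :=
  forall N : nat, exists a b : R, 0 < b /\
    forall k : nat, (1 <= k <= N)%N -> exists n, lam n = a + k%:R * b.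

Definition cexp (z : R[i]) : R[i] :=
  (expR (complex.Re z))%:C * (cos (complex.Im z) +i* sin (complex.Im z)).

(* Only the values of a on A matter. *)
Definition dirichlet_poly lam A a : R[i] -> R[i] :=
  fun s => \sum_(n <- A) a n * cexp (- ((lam n)%:C * s)).

(* The norm of R[i] takes its values in R[i]; normc is the R-valued modulus. *)
Definition modulus_it D (t : R) : R := Normc.normc (D (0 +i* t)).

(* The H_p norm of a Dirichlet polynomial for 1 <= p <= +oo; the value at
   p = -oo is a dummy. *)
Definition Hnorm p D : R :=
  match p with
  | q%:E => lim ((fun T : R =>
      ((2 * T)^-1 * \int[lebesgue_measure]_(t in `[- T, T])
         (modulus_it D t `^ q)) `^ q^-1) @ +oo)
  | +oo%E => sup (range (modulus_it D))
  | -oo%E => 0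
  end.

Definition is_unimodular A eps : Prop := forall n, n \in A -> `|eps n| = 1.

Definition one_eps lam eps A := dirichlet_poly lam A eps.

Definition one_set lam A := one_eps lam (fun=> 1) A.

(* The sets below are nonempty and consist of reals in [0, N] (for sup) or
   [0, +oo[ (for inf), so that the real-valued sup and inf are the genuine ones. *)
Definition phi_u p lam (N : nat) : R :=
  sup [set Hnorm p (one_set lam A) | A in [set A : {fset nat} | (#|` A| <= N)%N]].

Definition phi_l p lam (N : nat) : R :=
  inf [set Hnorm p (one_set lam A) | A in [set A : {fset nat} | (N <= #|` A|)%N]].

Definition phi_uE p lam (N : nat) : R :=
  sup [set x | exists A eps, [/\ (#|` A| <= N)%N, is_unimodular A eps
                               & x = Hnorm p (one_eps lam eps A)]].

Definition phi_lE p lam (N : nat) : R :=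
  inf [set x | exists A eps, [/\ (N <= #|` A|)%N, is_unimodular A eps
                               & x = Hnorm p (one_eps lam eps A)]].

Definition approx_from (N0 : nat) (f g : nat -> R) : Prop :=
  exists c C : R, [/\ 0 < c, 0 < C &
    forall N, (N0 <= N)%N -> c * g N <= f N <= C * g N].

Definition approx3_from (N0 : nat) (f g h : nat -> R) : Prop :=
  approx_from N0 f g /\ approx_from N0 g h.

End DirichletPolynomials.

(* Main.v *)
Require Import Defs.
From mathcomp Require Import all_boot all_order all_algebra finmap.
From mathcomp Require Import complex.
From mathcomp Require Import all_classical all_reals all_analysis.
From mathcomp Require Import ring lra.

(** The norms are read off from means over the line: for an exponential
polynomial F, the average of |F|^p over [-T, T] converges to a limit M|F|^p,
and the H_p norm is its p-th root. The limit exists because |F|^p is uniformly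
approximated by real trigonometric polynomials ([mean_nrm_powR], by Bernstein
polynomials in |F|^2), whose means are constant terms. So M|F|^2 is the number
N of terms when the coefficients are unimodular.

Half of the bounds hold for every frequency and every choice of coefficients.
They compare |F|^p pointwise with |F|^2, using |F| <= N or splitting at a
level of the order of sqrt N. The exception is the lower bound log N at p = 1, which is
the Littlewood inequality [littlewood]. It is proved by duality, with blocks of
frequencies that grow geometrically in the manner of McGehee, Pigno and Smith.
A test polynomial F bounded by 2 is replaced by F E + f, where f is the
normalised sum over the next block and E is a damping factor with spectrum in
(-oo, 0] which is small where |f| is large. The sup bound 2 survives, the new
block adds 1 to the pairing with the sum, and the damping costs at most 1/2, so
that the pairing is at least of the order of the number of blocks.

The other half asks for good sets. On an arithmetic progression of 2^k
frequencies the sum has the modulus of the Dirichlet kernel. Averaging the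
kernel over t and t + pi gives a recursion from 2^k to 2^(k+1) terms
([kernel_step]), hence log N at p = 1 and N^(p-1) for p > 1; the lower bound for
p >= 2 follows by interpolation ([kernel_Lp_lower]). The Rudin-Shapiro
coefficients give a sup norm of order sqrt N ([rudin_shapiro]). A set whose
elements grow fast enough has M|F|^(2j) <= j! N^j ([sparse_sets]), so that all
its norms with p finite are of order sqrt N; such sets exist for every
frequency. *)

Set Implicit Arguments.
Unset Strict Implicit.
Unset Printing Implicit Defensive.

Import Order.TTheory GRing.Theory Num.Theory.
Import numFieldNormedType.Exports.
Local Open Scope classical_set_scope.
Local Open Scope complex_scope.
Local Open Scope ring_scope.

Local Notation nrm := Normc.normc.

(** * Means over the real line *)

Section Mean.
Variable R : realType.
Implicit Types (g h : R -> R) (m T : R).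

Definition avg g (T : R) : R :=
  (2 * T)^-1 * \int[lebesgue_measure]_(t in `[- T, T]) g t.

(** The mean is asked to be the same along every nonconstant affine
change of variable. For almost periodic functions this is automatic, and it makes
translation and dilation invariance part of the notion. *)
Definition has_mean g m : Prop :=
  continuous g /\ forall c d : R, c != 0 ->
    avg (fun t => g (c * t + d)) T @[T --> +oo] --> m.

Lemma continuous_itv_integrable g (T : R) : continuous g ->
  (@lebesgue_measure R).-integrable `[- T, T] (EFin \o g).
Proof.
move=> cg; apply: continuous_compact_integrable; first exact: segment_compact.
by apply: continuous_subspaceT.
Qed.

Lemma continuous_affine g (c d : R) : continuous g ->
  continuous (fun t => g (c * t + d)).
Proof.
move=> cg t; apply: (@continuous_comp _ _ _ (fun t => c * t + d) g); last exact: cg.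
by apply: cvgD; [apply: cvgM; [exact: cvg_cst|exact: cvg_id]|exact: cvg_cst].
Qed.

Lemma avgD g h T : continuous g -> continuous h ->
  avg (fun t => g t + h t) T = avg g T + avg h T.
Proof.
move=> cg ch; rewrite /avg RintegralD.
- by rewrite mulrDr.
- exact: measurable_itv.
- exact: continuous_itv_integrable.
- exact: continuous_itv_integrable.
Qed.

Lemma avgZ g a T : continuous g -> avg (fun t => a * g t) T = a * avg g T.
Proof.
move=> cg; rewrite /avg RintegralZl; last exact: continuous_itv_integrable.
  by rewrite mulrCA.
exact: measurable_itv.
Qed.

Lemma le_avg g h T : continuous g -> continuous h -> 0 < T ->
  (forall t, g t <= h t) -> avg g T <= avg h T.
Proof.
move=> cg ch T0 gh; apply: ler_wpM2l; first by rewrite invr_ge0 mulr_ge0 ?ltW.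
apply: le_Rintegral => //; exact: continuous_itv_integrable.
Qed.

Lemma avg_cst a T : 0 < T -> avg (fun=> a) T = a.
Proof.
move=> T0; rewrite /avg Rintegral_cst//.
set M := fine _; have -> : M = 2 * T.
  transitivity (fine (lebesgue_measure `[- T, T]%classic)); first by [].
  rewrite lebesgue_measure_itv/= lte_fin ifT; last by rewrite gtrN.
  rewrite /=; lra.
by rewrite mulrCA mulVf ?mulr1// mulf_neq0 ?gt_eqF.
Qed.

Lemma avg_dist g h (e : R) T : continuous g -> continuous h -> 0 < T ->
  (forall t, `|g t - h t| <= e) -> `|avg g T - avg h T| <= e.
Proof.
move=> cg ch T0 gh.
have ce : continuous (fun _ : R => e) by move=> t; exact: cvg_cst.
have cD (k : R -> R) : continuous k -> continuous (fun t => k t + e).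
  by move=> ck t; apply: cvgD; [exact: ck|exact: ce].
rewrite ler_distl; apply/andP; split.
  rewrite lerBlDr -{1}(avg_cst e T0) -avgD//.
  apply: le_avg => //; first exact: cD.
  by move=> t; have := gh t; rewrite ler_distl; lra.
rewrite -{1}(avg_cst e T0) -avgD//.
apply: le_avg => //; first exact: cD.
by move=> t; have := gh t; rewrite ler_distl; lra.
Qed.

Lemma mean_continuous g m : has_mean g m -> continuous g.
Proof. by case. Qed.

Lemma mean_cst a : has_mean (fun=> a) a.
Proof.
split=> [t|c d c0]; first exact: cvg_cst.
apply: cvg_near_cst; near=> T; apply: avg_cst; near: T.
exact: nbhs_pinfty_gt.
Unshelve. all: by end_near. Qed.

Lemma meanD g h m m' : has_mean g m -> has_mean h m' ->
  has_mean (fun t => g t + h t) (m + m').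
Proof.
move=> [cg gm] [ch hm]; split=> [t|c d c0]; first by apply: cvgD; [exact: cg|exact: ch].
rewrite (funext (fun T => avgD T (continuous_affine (c := c) (d := d) cg)
  (continuous_affine (c := c) (d := d) ch))).
by apply: cvgD; [exact: gm|exact: hm].
Qed.

Lemma meanZ g m a : has_mean g m -> has_mean (fun t => a * g t) (a * m).
Proof.
move=> [cg gm]; split=> [t|c d c0].
  by apply: cvgM; [exact: cvg_cst|exact: cg].
rewrite (funext (fun T => avgZ a T (continuous_affine (c := c) (d := d) cg))).
by apply: cvgM; [exact: cvg_cst|exact: gm].
Qed.

Lemma mean_eq g h m m' : has_mean g m -> g =1 h -> m = m' -> has_mean h m'.
Proof. by move=> gm /funext <- <-. Qed.

Lemma mean_affine g m (c d : R) : c != 0 -> has_mean g m ->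
  has_mean (fun t => g (c * t + d)) m.
Proof.
move=> c0 [cg gm]; split=> [|c' d' c'0]; first exact: continuous_affine.
have := gm (c * c') (c * d' + d) (mulf_neq0 c0 c'0).
by under eq_fun do under eq_fun do rewrite -mulrA addrA -mulrDr.
Qed.

Lemma mean_cvg g m : has_mean g m -> avg g T @[T --> +oo] --> m.
Proof.
move=> [_ /(_ 1 0 (oner_neq0 _))].
by under eq_fun do under eq_fun do rewrite mul1r addr0.
Qed.

Lemma le_mean g h m m' : has_mean g m -> has_mean h m' ->
  (forall t, g t <= h t) -> m <= m'.
Proof.
move=> gm hm gh; have gm' := mean_cvg gm; have hm' := mean_cvg hm.
rewrite -(cvg_lim _ gm')// -(cvg_lim _ hm')//.
apply: ler_lim; [by apply: cvgP gm'|by apply: cvgP hm'|].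
near=> T; have T0 : 0 < T by near: T; exact: nbhs_pinfty_gt.
exact: (le_avg (mean_continuous gm) (mean_continuous hm) T0 gh).
Unshelve. all: by end_near. Qed.

Lemma mean_unique g m m' : has_mean g m -> has_mean g m' -> m = m'.
Proof. by move=> h h'; apply/le_anti; rewrite (le_mean h h')// (le_mean h' h). Qed.

Lemma mean_ge0 g m : has_mean g m -> (forall t, 0 <= g t) -> 0 <= m.
Proof. by move=> gm; apply: le_mean (mean_cst 0) gm. Qed.

(** Means pass to uniform limits, by completeness of the reals: the
limit mean is the supremum of the lower bounds m - e that the approximants
give. *)
Lemma mean_approx g : (forall e, 0 < e -> exists h m, has_mean h m /\
   forall t, `|g t - h t| <= e) -> exists m, has_mean g m.
Proof.
move=> gh.
have cg : continuous g.
  move=> t; apply/cvgrPdist_le => e e0.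
  have [h [m [[ch _] he]]] := gh _ (divr_gt0 e0 (ltr0n _ 3)).
  have /cvgrPdist_le /(_ _ (divr_gt0 e0 (ltr0n _ 3))) := ch t.
  apply: filterS => s hs.
  rewrite (_ : g t - g s = (g t - h t) + (h t - h s) - (g s - h s)); last by ring.
  rewrite (le_trans (ler_normB _ _))// (le_trans (lerD (ler_normD _ _) (lexx _)))//.
  have := he t; have := he s; lra.
(* a lower bound for the mean of g, from each approximant *)
pose S := [set x : R | exists e h m, [/\ 0 < e, has_mean h m,
   (forall t, `|g t - h t| <= e) & x = m - e]].
have SS e h m : 0 < e -> has_mean h m -> (forall t, `|g t - h t| <= e) ->
    forall x, S x -> x <= m + e.
  move=> e0 hm ghe x [e' [h' [m' [e'0 hm' ghe' ->]]]].
  suff : m' <= m + (e + e') by lra.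
  apply: (le_mean hm' (meanD hm (mean_cst (e + e')))) => t.
  have := ghe t; have := ghe' t; rewrite !ler_distl; lra.
have [h1 [m1 [hm1 ghe1]]] := gh 1 ltr01.
have S0 : S !=set0 by exists (m1 - 1), 1, h1, m1; split.
have Sb : has_ubound S by exists (m1 + 1) => x; exact: SS hm1 ghe1 x.
exists (sup S); split=> // c d c0; apply/cvgrPdist_le => e e0.
have e3 : 0 < e / 3 by rewrite divr_gt0.
have [h [m [hm ghe]]] := gh _ e3.
have Sm : `|sup S - m| <= e / 3.
  rewrite ler_distl; apply/andP; split.
    by apply: ub_le_sup => //; exists (e / 3), h, m; split.
  by apply: ge_sup => //; exact: SS hm ghe.
have [ch /(_ c d c0)/cvgrPdist_le /(_ _ e3)] := hm.
move=> near_h; near=> T.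
have T0 : 0 < T by near: T; exact: nbhs_pinfty_gt.
have A1 : `|m - avg (fun t => h (c * t + d)) T| <= e / 3 by near: T.
have A2 : `|avg (fun t => g (c * t + d)) T - avg (fun t => h (c * t + d)) T| <= e / 3.
  by apply: avg_dist => //; exact: continuous_affine.
by move: Sm A1 A2; rewrite !ler_distl; lra.
Unshelve. all: by end_near. Qed.

(** The integral over [-T, T] stays bounded, while the average
divides it by 2 T. *)
Lemma mean_primitive g (G : R -> R) (B : R) : continuous g ->
  (forall t : R, is_derive t (1 : R) G (g t)) -> (forall t, `|G t| <= B) ->
  avg g T @[T --> +oo] --> (0 : R).
Proof.
move=> cg dG GB; apply/cvgrPdist_lt => e e0; near=> T.
have T0 : 0 < T by near: T; exact: nbhs_pinfty_gt.
have TB : B / e < T by near: T; apply: nbhs_pinfty_gt; rewrite num_real.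
have cG : continuous G.
  by move=> t; apply: differentiable_continuous; apply/derivable1_diffP; case: (dG t).
have -> : avg g T = (2 * T)^-1 * (G T - G (- T)).
  congr (_ * _); rewrite /Rintegral (@continuous_FTC2 _ _ G) ?gtrN//.
  - exact: continuous_subspaceT.
  - split=> [x _||]; first by case: (dG x).
      by apply: cvg_at_right_filter; exact: cG.
    by apply: cvg_at_left_filter; exact: cG.
  - by move=> x _; rewrite derive1E; apply: derive_val.
rewrite sub0r normrN normrM ger0_norm ?invr_ge0 ?mulr_ge0 ?ltW//.
rewrite [ltLHS]mulrC ltr_pdivrMr ?mulr_gt0// (le_lt_trans (ler_normB _ _))//.
have := GB T; have := GB (- T); move: TB; rewrite ltr_pdivrMr//.
lra.
Unshelve. all: by end_near. Qed.

Lemma mean_cos (w : R) : has_mean (fun t => cos (w * t)) (w == 0)%:R.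
Proof.
have [->|w0] := eqVneq.
  by apply: mean_eq (mean_cst 1) _ _ => // t; rewrite mul0r cos0.
have ca x y : continuous (fun t : R => cos (x * t + y)).
  exact: continuous_affine (@continuous_cos R).
split=> [|c d c0].
  by have := ca w 0; under eq_fun do rewrite addr0.
have wc0 : w * c != 0 by rewrite mulf_neq0.
under eq_fun do under eq_fun do rewrite mulrDr mulrA.
apply: (@mean_primitive _ (fun t => (w * c)^-1 * sin (w * c * t + w * d)) (`|(w * c)^-1|)) => //.
  move=> t; apply: is_derive_eq.
  by rewrite /GRing.scale/= !mulr1 !addr0; field; rewrite c0.
by move=> t; rewrite normrM ler_piMr ?normr_ge0// sin_max.
Qed.

Lemma mean_sin (w : R) : has_mean (fun t => sin (w * t)) 0.
Proof.
have [->|w0] := eqVneq w 0.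
  by apply: mean_eq (mean_cst 0) _ _ => // t; rewrite mul0r sin0.
have ca x y : continuous (fun t : R => sin (x * t + y)).
  exact: continuous_affine (@continuous_sin R).
split=> [|c d c0].
  by have := ca w 0; under eq_fun do rewrite addr0.
have wc0 : w * c != 0 by rewrite mulf_neq0.
under eq_fun do under eq_fun do rewrite mulrDr mulrA.
apply: (@mean_primitive _ (fun t => - (w * c)^-1 * cos (w * c * t + w * d)) (`|(w * c)^-1|)) => //.
  move=> t; apply: is_derive_eq.
  by rewrite /GRing.scale/= !mulr1 !addr0; field; rewrite c0.
by move=> t; rewrite normrM normrN ler_piMr ?normr_ge0// cos_max.
Qed.

End Mean.

(** * Exponential polynomials and their spectra *)

Section ExpPoly.
Variable R : realType.
Implicit Types (z : R[i]) (w t m : R) (F G : R -> R[i]) (S U : set R).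

Lemma nrm_ge0 z : 0 <= nrm z.
Proof. by case: z => a b; exact: sqrtr_ge0. Qed.

Lemma nrm_sqr z : nrm z ^+ 2 = complex.Re z ^+ 2 + complex.Im z ^+ 2.
Proof. by case: z => a b; rewrite /= sqr_sqrtr// addr_ge0 ?sqr_ge0. Qed.

Lemma nrm_sqrE z : nrm z ^+ 2 = complex.Re (z * z^*%C).
Proof. by rewrite nrm_sqr; case: z => a b /=; ring. Qed.

Lemma nrmJ z : nrm z^*%C = nrm z.
Proof. by case: z => a b /=; rewrite sqrrN. Qed.

Lemma nrmX z n : nrm (z ^+ n) = nrm z ^+ n.
Proof. by elim: n => [|n IH]; rewrite ?Normc.normc1// !exprS Normc.normcM IH. Qed.

Lemma nrm_real (a : R) : nrm a%:C = `|a|.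
Proof. by rewrite /= expr0n addr0 sqrtr_sqr. Qed.

Lemma Re_le_nrm z : complex.Re z <= nrm z.
Proof.
case: z => a b /=; rewrite (le_trans (ler_norm a))// -sqrtr_sqr ler_sqrt.
  by rewrite lerDl sqr_ge0.
by rewrite addr_ge0 ?sqr_ge0.
Qed.

Lemma ReD z z' : complex.Re (z + z') = complex.Re z + complex.Re z'.
Proof. by case: z z' => a b []. Qed.

Lemma nrm_sqrD z z' :
  nrm (z + z') ^+ 2 = nrm z ^+ 2 + nrm z' ^+ 2 + 2 * complex.Re (z * z'^*%C).
Proof. by rewrite !nrm_sqr; case: z z' => [a b] [c d] /=; ring. Qed.

(** The oscillation exp(- i w t), with the sign convention of Dirichlet
series on the imaginary axis. *)
Definition ch w t : R[i] := cos (w * t) -i* sin (w * t).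

Lemma ch0 t : ch 0 t = 1.
Proof. by rewrite /ch mul0r cos0 sin0 oppr0. Qed.

Lemma chD w w' t : ch (w + w') t = ch w t * ch w' t.
Proof. by rewrite /ch mulrDl cosD sinD; apply/eqP; rewrite eq_complex /=;
  apply/andP; split; apply/eqP; ring. Qed.

Lemma chJ w t : (ch w t)^*%C = ch (- w) t.
Proof. by rewrite /ch /= mulNr cosN sinN opprK. Qed.

Lemma nrm_ch w t : nrm (ch w t) = 1.
Proof. by rewrite /ch /= sqrrN cos2Dsin2 sqrtr1. Qed.

Lemma ch_scale w c t : ch w (c * t) = ch (w * c) t.
Proof. by rewrite /ch mulrA. Qed.

Lemma chMn w n t : ch (n%:R * w) t = ch w t ^+ n.
Proof.
elim: n => [|n IH]; first by rewrite mul0r ch0.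
by rewrite mulrS mulrDl mul1r chD IH exprS.
Qed.

(** Exponential polynomials with spectrum in S, generated term by term; a
frequency may occur several times, or with coefficient 0. *)
Inductive EP S : (R -> R[i]) -> Prop :=
| EP0 : EP S (fun=> 0)
| EPcons c w F : S w -> EP S F -> EP S (fun t => c * ch w t + F t).

Lemma EP_eq S F G : EP S F -> F =1 G -> EP S G.
Proof. by move=> SF /funext <-. Qed.

Lemma EP_sub S U F : (forall w, S w -> U w) -> EP S F -> EP U F.
Proof. by move=> SU; elim=> [|c w G /SU Uw _ UG]; constructor. Qed.

Lemma EPD S F G : EP S F -> EP S G -> EP S (fun t => F t + G t).
Proof.
move=> + SG; elim=> [|c w F' Sw _ IH].
  by apply: EP_eq SG _ => t; rewrite add0r.
by apply: EP_eq (EPcons c Sw IH) _ => t; rewrite addrA.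
Qed.

Lemma EPZch S U c w F : (forall v, S v -> U (w + v)) -> EP S F ->
  EP U (fun t => c * ch w t * F t).
Proof.
move=> SU; elim=> [|c' w' F' Sw _ IH].
  by apply: EP_eq (EP0 _) _ => t; rewrite mulr0.
apply: EP_eq (EPcons (c * c') (SU _ Sw) IH) _ => t.
by rewrite chD; ring.
Qed.

Lemma EPZ S c F : EP S F -> EP S (fun t => c * F t).
Proof.
move=> SF; apply: (@EP_eq S (fun t => c * ch 0 t * F t)).
  by apply: EPZch SF => v; rewrite add0r.
by move=> t; rewrite ch0 mulr1.
Qed.

Lemma EPB S F G : EP S F -> EP S G -> EP S (fun t => F t - G t).
Proof.
move=> SF SG; apply: EP_eq (EPD SF (EPZ (-1) SG)) _ => t.
by rewrite mulN1r.
Qed.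

Lemma EPch S w : S w -> EP S (ch w).
Proof.
by move=> Sw; apply: EP_eq (EPcons 1 Sw (EP0 S)) _ => t; rewrite mul1r addr0.
Qed.

Lemma EP_cst S c : S 0 -> EP S (fun=> c).
Proof.
move=> S0; apply: EP_eq (EPZ c (EPch S0)) _ => t.
by rewrite ch0 mulr1.
Qed.

Lemma EPM S U V F G : (forall x y, S x -> U y -> V (x + y)) ->
  EP S F -> EP U G -> EP V (fun t => F t * G t).
Proof.
move=> SUV SF UG; elim: SF => [|c w F' Sw _ IH].
  by apply: EP_eq (EP0 _) _ => t; rewrite mul0r.
apply: EP_eq (EPD (EPZch c (fun v Uv => SUV w v Sw Uv) UG) IH) _ => t.
by rewrite mulrDl.
Qed.

Lemma EPJ S U F : (forall x, S x -> U (- x)) -> EP S F ->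
  EP U (fun t => (F t)^*%C).
Proof.
move=> SU; elim=> [|c w F' Sw _ IH].
  by apply: EP_eq (EP0 _) _ => t; rewrite conjc0.
apply: EP_eq (EPcons c^*%C (SU _ Sw) IH) _ => t.
by rewrite -chJ; case: (F' t) (ch w t) c => [x y] [x' y'] [x'' y'']; congr Complex; rewrite /=; ring.
Qed.

Lemma EPX S F n : S 0 -> (forall x y, S x -> S y -> S (x + y)) -> EP S F ->
  EP S (fun t => F t ^+ n).
Proof.
move=> S0 SD SF; elim: n => [|n IH].
  by apply: EP_eq (EP_cst 1 S0) _ => t; rewrite expr0.
by apply: EP_eq (EPM SD SF IH) _ => t; rewrite exprS.
Qed.

Lemma EP_sum S I (s : seq I) (P : pred I) (F : I -> R -> R[i]) :
  (forall i, P i -> EP S (F i)) -> EP S (fun t => \sum_(i <- s | P i) F i t).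
Proof.
move=> SF; elim: s => [|i s IH].
  by apply: EP_eq (EP0 _) _ => t; rewrite big_nil.
have [Pi|Pi] := boolP (P i).
  by apply: EP_eq (EPD (SF i Pi) IH) _ => t; rewrite big_cons Pi.
by apply: EP_eq IH _ => t; rewrite big_cons (negbTE Pi).
Qed.

Lemma EP_bounded S F : EP S F -> exists2 B : R, 0 < B & forall t, nrm (F t) <= B.
Proof.
elim=> [|c w G _ _ [B B0 GB]].
  by exists 1 => // t; rewrite Normc.normc0.
exists (nrm c + B); first by rewrite ltr_wpDl ?nrm_ge0.
move=> t; rewrite (le_trans (le_normcD _ _))// Normc.normcM nrm_ch mulr1.
by rewrite lerD2l.
Qed.

Lemma Re_mul_ch c w t : complex.Re (c * ch w t) =
  complex.Re c * cos (w * t) + complex.Im c * sin (w * t).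
Proof. by case: c => a b /=; ring. Qed.

Lemma mean_Re_ch c w :
  has_mean (fun t => complex.Re (c * ch w t)) (complex.Re c * (w == 0)%:R).
Proof.
apply: mean_eq (meanD (meanZ (complex.Re c) (mean_cos w))
  (meanZ (complex.Im c) (mean_sin w))) _ _.
  by move=> t; rewrite Re_mul_ch.
by rewrite mulr0 addr0.
Qed.

Lemma EP_mean S F : EP S F -> exists m, has_mean (fun t => complex.Re (F t)) m.
Proof.
elim=> [|c w G _ _ [m mG]]; first by exists 0; exact: mean_cst.
exists (complex.Re c * (w == 0)%:R + m).
by apply: mean_eq (meanD (mean_Re_ch c w) mG) _ _ => // t; rewrite ReD.
Qed.

(** Only the frequency 0 contributes to a mean. *)
Lemma EP_mean0 S F : ~ S 0 -> EP S F -> has_mean (fun t => complex.Re (F t)) 0.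
Proof.
move=> S0; elim=> [|c w G Sw _ mG]; first exact: mean_cst.
apply: mean_eq (meanD (mean_Re_ch c w) mG) _ _; first by move=> t; rewrite ReD.
case: eqP => [w0|_]; first by case: S0; rewrite -w0.
by rewrite mulr0 addr0.
Qed.

Lemma mean_nrm2_ch c w : has_mean (fun t => nrm (c * ch w t) ^+ 2) (nrm c ^+ 2).
Proof.
by apply: mean_eq (mean_cst (nrm c ^+ 2)) _ _ => // t; rewrite Normc.normcM nrm_ch mulr1.
Qed.

(** The frequencies of F times the conjugate of G are differences of
frequencies of F and G. *)
Lemma mean_cross0 S U F G : (forall x y, S x -> U y -> x != y) ->
  EP S F -> EP U G -> has_mean (fun t => complex.Re (F t * (G t)^*%C)) 0.
Proof.
move=> SU SF UG; apply: (@EP_mean0 [set x : R | x != 0]); first by rewrite /= eqxx.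
have UJ := EPJ (U := [set y | exists2 z, U z & y = - z])
  (fun x Ux => ex_intro2 _ _ x Ux erefl) UG.
apply: EPM SF UJ => x y Sx [z Uz ->] /=.
by rewrite subr_eq0 SU.
Qed.

(** Pythagoras: disjoint spectra make the cross terms vanish in mean. *)
Lemma mean_nrm2D S U F G m m' : (forall x y, S x -> U y -> x != y) ->
  EP S F -> EP U G ->
  has_mean (fun t => nrm (F t) ^+ 2) m -> has_mean (fun t => nrm (G t) ^+ 2) m' ->
  has_mean (fun t => nrm (F t + G t) ^+ 2) (m + m').
Proof.
move=> SU SF UG mF mG.
apply: mean_eq (meanD (meanD mF mG) (meanZ 2 (mean_cross0 SU SF UG))) _ _.
  by move=> t; rewrite nrm_sqrD.
by rewrite mulr0 addr0.
Qed.

Lemma EP_lincomb (I : eqType) (s : seq I) (c : I -> R[i]) (w : I -> R) (S : set R) :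
  (forall i, i \in s -> S (w i)) ->
  EP S (fun t => \sum_(i <- s) c i * ch (w i) t).
Proof.
move=> Sw; apply: (@EP_eq _ (fun t => \sum_(i <- s | i \in s) c i * ch (w i) t)).
  by apply: EP_sum => i si; apply: EPZ; apply: EPch; exact: Sw.
by move=> t; rewrite -big_seq.
Qed.

Lemma parseval (I : eqType) (s : seq I) (c : I -> R[i]) (w : I -> R) :
  uniq s -> {in s &, injective w} ->
  has_mean (fun t => nrm (\sum_(i <- s) c i * ch (w i) t) ^+ 2)
    (\sum_(i <- s) nrm (c i) ^+ 2).
Proof.
elim: s => [|i s IH] /=.
  by move=> _ _; apply: mean_eq (mean_cst 0) _ _ => [t|]; rewrite ?big_nil// Normc.normc0 expr0n.
move=> /andP[nis us] winj.
have winj' : {in s &, injective w}.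
  by move=> x y xs ys; apply: winj; rewrite inE ?xs ?ys orbT.
apply: mean_eq (mean_nrm2D (S := [set w i])
  (U := [set x | exists2 j, j \in s & x = w j]) _ _ _ (mean_nrm2_ch (c i) (w i)) (IH us winj')) _ _.
- move=> x y -> [j js ->]; apply: contraNneq nis => wij.
  by rewrite (winj i j)// ?inE ?eqxx// js orbT.
- by apply: EPZ; exact: EPch.
- by apply: EP_lincomb => j js; exists j.
- by move=> t; rewrite big_cons.
- by rewrite big_cons.
Qed.

Lemma mean_orthogonal_sum n (G : nat -> R -> R[i]) (S : nat -> set R) (b : nat -> R) :
  (forall i k x, (i < k < n)%N -> S i x -> ~ S k x) ->
  (forall i, (i < n)%N -> EP (S i) (G i)) ->
  (forall i, (i < n)%N -> has_mean (fun t => nrm (G i t) ^+ 2) (b i)) ->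
  has_mean (fun t => nrm (\sum_(i < n) G i t) ^+ 2) (\sum_(i < n) b i).
Proof.
elim: n => [|n IH] dS SG hb.
  by apply: mean_eq (mean_cst 0) _ _ => [t|]; rewrite ?big_ord0// Normc.normc0 expr0n.
apply: mean_eq (mean_nrm2D (S := [set x | exists2 i : nat, (i < n)%N & S i x])
  (U := S n) _ _ (SG n _) (IH _ _ _) (hb n _)) _ _ => //.
- move=> x y [i iN Six] Sny; apply/eqP => xy; apply: (dS i n x) => //.
    by rewrite iN ltnS leqnn.
  by rewrite xy.
- apply: (@EP_eq _ (fun t => \sum_(i < n | (i < n)%N) G i t)).
    by apply: EP_sum => i iN; apply: EP_sub (SG i (leqW iN)) => x Sx; exists i.
  by move=> t; apply: eq_bigl => i; rewrite ltn_ord.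
- by move=> i k x /andP[ik kn]; apply: dS; rewrite ik leqW.
- by move=> i iN; apply: SG; exact: leqW.
- by move=> i iN; apply: hb; exact: leqW.
- by move=> t; rewrite big_ord_recr.
- by rewrite big_ord_recr.
Qed.

Definition trig (g : R -> R) := exists2 F, EP setT F & forall t, g t = complex.Re (F t).

Lemma trig_eq (g h : R -> R) : trig g -> g =1 h -> trig h.
Proof. by move=> gt /funext <-. Qed.

Lemma trig_Re S F : EP S F -> trig (fun t => complex.Re (F t)).
Proof. by move=> SF; exists F => //; exact: EP_sub SF. Qed.

Lemma trig_cst a : trig (fun=> a).
Proof. by exists (fun=> a%:C) => //; exact: EP_cst. Qed.

Lemma trigD g h : trig g -> trig h -> trig (fun t => g t + h t).
Proof.
move=> [F SF gF] [G SG hG]; exists (fun t => F t + G t); first exact: EPD.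
by move=> t; rewrite ReD gF hG.
Qed.

Lemma trigM g h : trig g -> trig h -> trig (fun t => g t * h t).
Proof.
move=> [F SF gF] [G SG hG].
have SJ := EPJ (fun x _ => I : setT (- x)) SG.
have D x y (_ : setT x) (_ : setT y) := I : setT (x + y : R).
exists (fun t => 2^-1%:C * (F t * G t + F t * (G t)^*%C)).
  by apply: EPZ; apply: EPD; [exact: EPM D SF SG|exact: EPM D SF SJ].
move=> t; rewrite gF hG; case: (F t) (G t) => [a b] [c d] /=.
by field.
Qed.

Lemma trigZ a g : trig g -> trig (fun t => a * g t).
Proof. exact: trigM (trig_cst a). Qed.

Lemma trigX g n : trig g -> trig (fun t => g t ^+ n).
Proof.
move=> tg; elim: n => [|n IH].
  by apply: trig_eq (trig_cst 1) _ => t; rewrite expr0.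
by apply: trig_eq (trigM tg IH) _ => t; rewrite exprS.
Qed.

Lemma trig_nrm2 S F : EP S F -> trig (fun t => nrm (F t) ^+ 2).
Proof.
move=> SF; apply: (@trig_eq (fun t => complex.Re (F t * (F t)^*%C))).
  apply: (@trig_Re setT).
  exact: (EPM (fun x y _ _ => I : setT (x + y)) SF (EPJ (fun x _ => I : setT (- x)) SF)).
by move=> t; rewrite nrm_sqrE.
Qed.

Lemma trig_mean g : trig g -> exists m, has_mean g m.
Proof.
move=> [F SF gF]; have [m mF] := EP_mean SF; exists m.
by apply: mean_eq mF _ _ => // t; rewrite gF.
Qed.

(** Analytic completion: a real polynomial is the real part of a
constant plus a polynomial with negative spectrum, since conjugation moves a
positive frequency to the opposite one inside a real part. *)
Lemma trig_analytic g : trig g -> exists (c : R) H,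
  EP [set x : R | x < 0] H /\ forall t, g t = c + complex.Re (H t).
Proof.
move=> [F SF gF]; rewrite (funext gF) {gF}; elim: SF => [|a w G _ _ [c [H [SH GH]]]].
  by exists 0, (fun=> 0); split=> [|t]; [exact: EP0|rewrite addr0].
have [w0|w0|->] := ltgtP w 0.
- exists c, (fun t => a * ch w t + H t); split; first exact: EPcons.
  by move=> t; rewrite !ReD GH; ring.
- exists c, (fun t => a^*%C * ch (- w) t + H t); split.
    by apply: EPcons => //=; rewrite oppr_lt0.
  move=> t; rewrite !ReD GH !Re_mul_ch mulNr cosN sinN.
  by case: a => a b /=; ring.
- exists (complex.Re a + c), H; split=> // t.
  by rewrite ReD GH ch0 mulr1 addrA.
Qed.

End ExpPoly.

(** * Powers of the modulus have means *)

Section Bernstein.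
Variable R : realType.
Implicit Types (x e K : R) (h : nat -> R) (phi g : R -> R).

(** The Bernstein operator, as the expectation of h over the number of
successes in n trials of probability x. The recursion conditions on one trial, so
that no binomial coefficient appears. *)
Fixpoint bern n h x : R :=
  if n is n'.+1 then x * bern n' (h \o succn) x + (1 - x) * bern n' h x else h 0.

Lemma bern_le n h h' x : 0 <= x <= 1 ->
  (forall k, (k <= n)%N -> h k <= h' k) -> bern n h x <= bern n h' x.
Proof.
move=> /andP[x0 x1]; elim: n h h' => [|n IH] h h' hh /=; first exact: hh.
apply: lerD; apply: ler_wpM2l; rewrite ?subr_ge0//; apply: IH => k kn /=.
  exact: hh.
by apply: hh; exact: leqW.
Qed.

Lemma bern_affine n h x a b :
  bern n (fun k => a + b * h k) x = a + b * bern n h x.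
Proof.
elim: n h => [//|n IH] h /=.
rewrite (_ : _ \o _ = fun k => a + b * (h \o succn) k)// !IH; ring.
Qed.

(** The variance of a binomial law, with a shift c that lets the
induction on n go through. *)
Lemma bern_var n x c :
  bern n (fun k => (k%:R + c - n%:R * x) ^+ 2) x = n%:R * x * (1 - x) + c ^+ 2.
Proof.
elim: n c => [|n IH] c /=; first by rewrite !mul0r add0r subr0 add0r.
rewrite (_ : _ \o _ = fun k => (k%:R + (c + 1 - x) - n%:R * x) ^+ 2); last first.
  by apply/funext => k /=; rewrite -!natr1; congr (_ ^+ 2); ring.
rewrite [in X in _ + X](_ : (fun k => _) =
    fun k => (k%:R + (c - x) - n%:R * x) ^+ 2); last first.
  by apply/funext => k; rewrite -!natr1; congr (_ ^+ 2); ring.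
rewrite !IH -natr1; ring.
Qed.

Lemma bern_approx phi e K n x : 0 <= x <= 1 -> 0 <= K ->
  (forall y z, 0 <= y <= 1 -> 0 <= z <= 1 ->
     `|phi y - phi z| <= e + K * (y - z) ^+ 2) ->
  `|phi x - bern n.+1 (fun k => phi (k%:R / n.+1%:R)) x| <= e + K / n.+1%:R.
Proof.
move=> x01 K0 phiK; set N := n.+1.
have N0 : 0 < N%:R :> R by rewrite ltr0n.
have kN k : (k <= N)%N -> `|phi x - phi (k%:R / N%:R)| <=
    e + K / N%:R ^+ 2 * (k%:R + 0 - N%:R * x) ^+ 2.
  move=> kN; have -> : K / N%:R ^+ 2 * (k%:R + 0 - N%:R * x) ^+ 2 =
      K * (x - k%:R / N%:R) ^+ 2 by field; rewrite gt_eqF.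
  by apply: phiK => //; rewrite divr_ge0//= ler_pdivrMr// mul1r ler_nat.
have V : K / N%:R ^+ 2 * (N%:R * x * (1 - x) + 0 ^+ 2) <= K / N%:R.
  have -> : K / N%:R ^+ 2 * (N%:R * x * (1 - x) + 0 ^+ 2) = K / N%:R * (x * (1 - x)).
    by field; rewrite gt_eqF.
  by rewrite ler_piMr ?divr_ge0//; case/andP: x01 => ? ?; nra.
move: V; set W := _ + 0 ^+ 2; move: (K / N%:R) => r V.
rewrite distrC ler_distl; apply/andP; split.
- rewrite (le_trans _ (_ : (phi x - e) + - (K / N%:R ^+ 2) *
      bern N (fun k => (k%:R + 0 - N%:R * x) ^+ 2) x <= _))//.
    by rewrite bern_var -/W ?mulNr; lra.
  rewrite -bern_affine; apply: bern_le => // k /kN; rewrite ler_distl; lra.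
- rewrite (le_trans (_ : _ <= (phi x + e) + (K / N%:R ^+ 2) *
      bern N (fun k => (k%:R + 0 - N%:R * x) ^+ 2) x))//; last first.
    by rewrite bern_var -/W ?mulNr; lra.
  rewrite -bern_affine; apply: bern_le => // k /kN; rewrite ler_distl; lra.
Qed.

Lemma trig_bern n h g : trig g -> trig (fun t => bern n h (g t)).
Proof.
move=> tg; elim: n h => [|n IH] h /=; first exact: trig_cst.
apply: trigD; apply: trigM => //.
apply: trig_eq (trigD (trig_cst 1) (trigZ (-1) tg)) _ => t.
by rewrite mulN1r.
Qed.

(** Weierstrass approximation inside the trigonometric
polynomials: a Bernstein polynomial of a trigonometric polynomial is again one. The
quadratic form of the modulus of continuity is what the variance estimate
consumes. *)
Lemma trig_comp_approx phi g :
  (forall e, 0 < e -> exists2 K, 0 <= K &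
    forall y z, 0 <= y <= 1 -> 0 <= z <= 1 ->
     `|phi y - phi z| <= e + K * (y - z) ^+ 2) ->
  trig g -> (forall t, 0 <= g t <= 1) ->
  forall e, 0 < e -> exists2 q, trig q & forall t, `|phi (g t) - q t| <= e.
Proof.
move=> phiK tg g01 e e0.
have e2 : 0 < e / 2 by rewrite divr_gt0.
have [K K0 HK] := phiK _ e2.
pose n := Num.truncn (K / (e / 2)).
exists (fun t => bern n.+1 (fun k => phi (k%:R / n.+1%:R)) (g t)).
  exact: trig_bern.
move=> t; rewrite (le_trans (bern_approx n (g01 t) K0 HK))//.
have : K / n.+1%:R <= e / 2.
  rewrite ler_pdivrMr ?ltr0n// mulrC -ler_pdivrMr//.
  by apply: ltW; exact: truncnS_gt.
by move: (K / _) => r; lra.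
Qed.

(** The tangent inequality for the convex function u^p at its right
end, obtained from Young's inequality. *)
Lemma powR_lipschitz (p u v : R) : 1 <= p -> 0 <= v -> v <= u -> u <= 1 ->
  u `^ p - v `^ p <= p * (u - v).
Proof.
rewrite le_eqVlt => /predU1P[<-|p1] v0 vu u1.
  by rewrite !powRr1 ?mul1r// (le_trans v0).
have u0 : 0 <= u by exact: le_trans vu.
have p0 : 0 < p by lra.
have pm0 : 0 < p - 1 by lra.
have := @conjugate_powR _ v (u `^ (p - 1)) p (p / (p - 1)) v0 (powR_ge0 _ _) p0.
rewrite divr_gt0// => /(_ isT).
have -> : p^-1 + (p / (p - 1))^-1 = 1 by field; rewrite ?gt_eqF.
move=> /(_ erefl); rewrite -powRrM.
have -> : (p - 1) * (p / (p - 1)) = p by field; rewrite ?gt_eqF.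
have up := mulr_powRB1 u0 p0.
set y := u `^ (p - 1) in up *.
have y1 : y <= 1.
  have -> : 1 = 1 `^ (p - 1) by rewrite powR1.
  by apply: ge0_ler_powR; rewrite ?nnegrE// ltW.
have y0 : 0 <= y by exact: powR_ge0.
rewrite -up -(ler_pM2l p0).
have -> : p * (v `^ p / p + u * y / (p / (p - 1))) = v `^ p + (p - 1) * (u * y).
  by field; rewrite ?gt_eqF.
move=> H; have : p * (u - v) * y <= p * (u - v).
  by rewrite ler_piMr// mulr_ge0 ?subr_ge0// ltW.
lra.
Qed.

(** The modulus of continuity of y^(p/2) on [0, 1], by composing
the Lipschitz bound of u^p with |sqrt y - sqrt z|^2 <= |y - z|. *)
Lemma powR_sqrt_modulus (p : R) : 1 <= p -> forall e, 0 < e ->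
  exists2 K, 0 <= K & forall y z, 0 <= y <= 1 -> 0 <= z <= 1 ->
     `|Num.sqrt y `^ p - Num.sqrt z `^ p| <= e + K * (y - z) ^+ 2.
Proof.
move=> p1 e e0; pose c := p ^+ 2 / (2 * e).
exists (c ^+ 2 / (2 * e)); first by rewrite divr_ge0 ?sqr_ge0 ?mulr_ge0// ltW.
have p0 : 0 < p by lra.
move=> y z; wlog zy : y z / z <= y.
  move=> W y01 z01; have [/W|/ltW/W] := leP z y; first exact.
  by rewrite distrC (_ : (y - z) ^+ 2 = (z - y) ^+ 2); [apply|ring].
move=> /andP[y0 y1] /andP[z0 z1].
have szy : Num.sqrt z <= Num.sqrt y by rewrite ler_sqrt.
have sy1 : Num.sqrt y <= 1 by rewrite -sqrtr1 ler_sqrt.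
have L := powR_lipschitz p1 (sqrtr_ge0 z) szy sy1.
rewrite ger0_norm; last first.
  rewrite subr_ge0; apply: ge0_ler_powR; rewrite ?nnegrE ?sqrtr_ge0//; lra.
apply: (le_trans L).
have := sqr_sqrtr y0; have := sqr_sqrtr z0.
have := sqrtr_ge0 z; move: szy.
set a := Num.sqrt y; set b := Num.sqrt z => ba b0 <- <-.
set d := a - b; set s := a ^+ 2 - b ^+ 2.
have d0 : 0 <= d by rewrite subr_ge0.
have ds : d ^+ 2 <= s by rewrite /d /s; nra.
have A : p * d <= e / 2 + c * d ^+ 2.
  rewrite -subr_ge0 (_ : _ - _ = (2 * e)^-1 * (e - p * d) ^+ 2).
    by rewrite mulr_ge0 ?sqr_ge0// invr_ge0 mulr_ge0 ?ltW.
  by rewrite /c; field; rewrite gt_eqF.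
have B : c * s <= e / 2 + c ^+ 2 / (2 * e) * s ^+ 2.
  rewrite -subr_ge0 (_ : _ - _ = (2 * e)^-1 * (e - c * s) ^+ 2).
    by rewrite mulr_ge0 ?sqr_ge0// invr_ge0 mulr_ge0 ?ltW.
  by field; rewrite gt_eqF.
have : c * d ^+ 2 <= c * s.
  by rewrite ler_wpM2l// /c divr_ge0 ?sqr_ge0// mulr_ge0 ?ltW.
lra.
Qed.

(** The modulus itself is not a polynomial, but its square is; the
power p of the modulus is a continuous function of that square. *)
Lemma nrm_powR_approx S (F : R -> R[i]) (p e : R) : EP S F -> 1 <= p -> 0 < e ->
  exists2 q, trig q & forall t, `|nrm (F t) `^ p - q t| <= e.
Proof.
move=> SF p1 e0; have [B B0 FB] := EP_bounded SF.
have Bp0 : 0 < B `^ p by exact: powR_gt0.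
pose g t := (B ^+ 2)^-1 * nrm (F t) ^+ 2.
have gE t : g t = (nrm (F t) / B) ^+ 2 by rewrite /g expr_div_n mulrC.
have FB0 t : 0 <= nrm (F t) / B by rewrite divr_ge0 ?nrm_ge0// ltW.
have tg : trig g by apply: trigZ; exact: trig_nrm2 SF.
have g01 t : 0 <= g t <= 1.
  rewrite gE sqr_ge0 /= expr_le1// ler_pdivrMr// mul1r//.
have [q tq gq] := trig_comp_approx (powR_sqrt_modulus p1) tg g01 (divr_gt0 e0 Bp0).
exists (fun t => B `^ p * q t); first exact: trigZ.
move=> t; have := gq t; rewrite gE sqrtr_sqr (ger0_norm (FB0 t)) => H.
have -> : nrm (F t) `^ p - B `^ p * q t = B `^ p * ((nrm (F t) / B) `^ p - q t).
  rewrite mulrBr -powRM//; last exact: ltW.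
  by rewrite mulrCA divff ?mulr1 ?gt_eqF.
by rewrite normrM (gtr0_norm Bp0) mulrC -ler_pdivlMr.
Qed.

Lemma mean_nrm_powR S (F : R -> R[i]) (p : R) : EP S F -> 1 <= p ->
  exists m, has_mean (fun t => nrm (F t) `^ p) m.
Proof.
move=> SF p1; apply: mean_approx => e e0.
have [q tq qF] := nrm_powR_approx SF p1 e0.
by have [m qm] := trig_mean tq; exists q, m.
Qed.

End Bernstein.

(** * Inequalities between powers *)

Section PowerInequalities.
Variable R : realType.
Implicit Types (s x a b p q r N : R).

Lemma powR_mul x a b : 0 < x -> x `^ a * x `^ b = x `^ (a + b).
Proof. by move=> x0; rewrite powRD// (gt_eqF x0) implybT. Qed.

Lemma powR_split N x p q : 0 <= x -> x <= N -> 0 < p -> p <= q ->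
  x `^ q <= N `^ (q - p) * x `^ p.
Proof.
move=> x0 xN p0 pq.
have -> : x `^ q = x `^ (q - p) * x `^ p.
  rewrite -powRD ?subrK//; apply/implyP => /eqP; lra.
rewrite ler_wpM2r ?powR_ge0//; apply: ge0_ler_powR => //; rewrite ?nnegrE ?subr_ge0//.
exact: le_trans xN.
Qed.

(** The first term dominates for x <= s, the second for x >= s. With a
level s adapted to the L^2 norm, the means of different powers get compared at the
cost of a constant. *)
Lemma powR_interp0 s x q r : 0 < s -> 0 <= x -> 0 < q -> q <= r ->
  x `^ q <= s `^ q + s `^ (q - r) * x `^ r.
Proof.
move=> s0 + q0 qr; rewrite le_eqVlt => /predU1P[<-|x0].
  by rewrite !powR0 ?mulr0 ?addr0 ?powR_ge0// gt_eqF//; lra.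
have [xs|sx] := leP x s.
  rewrite (@le_trans _ _ (s `^ q))//; last by rewrite lerDl mulr_ge0 ?powR_ge0.
  by apply: ge0_ler_powR; rewrite ?nnegrE ?(ltW q0) ?(ltW x0) ?(ltW s0).
rewrite (@le_trans _ _ (s `^ (q - r) * x `^ r))//; last by rewrite lerDr powR_ge0.
rewrite [leLHS](_ : _ = x `^ (q - r) * x `^ r); last by rewrite powR_mul// subrK.
rewrite ler_wpM2r ?powR_ge0//.
rewrite -(opprB r q) !powRN lef_pV2 ?posrE ?powR_gt0//.
by apply: ge0_ler_powR; rewrite ?nnegrE ?subr_ge0// ltW.
Qed.

(** The same dichotomy at the level s, between two powers. *)
Lemma powR_interp s x p q r : 0 < s -> 0 <= x -> 0 < p -> p <= q -> q <= r ->
  x `^ q <= s `^ (q - p) * x `^ p + s `^ (q - r) * x `^ r.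
Proof.
move=> s0 + p0 pq qr; rewrite le_eqVlt => /predU1P[<-|x0].
  by rewrite !powR0 ?mulr0 ?addr0// gt_eqF//; lra.
have [xs|sx] := leP x s.
  rewrite (@le_trans _ _ (s `^ (q - p) * x `^ p))//; last first.
    by rewrite lerDl mulr_ge0 ?powR_ge0.
  rewrite [leLHS](_ : _ = x `^ (q - p) * x `^ p); last first.
    by rewrite -powRD ?subrK// (gt_eqF x0) implybT.
  rewrite ler_wpM2r ?powR_ge0//.
  by apply: ge0_ler_powR; rewrite ?nnegrE ?subr_ge0// ltW.
rewrite (@le_trans _ _ (s `^ (q - r) * x `^ r))//; last first.
  by rewrite lerDr mulr_ge0 ?powR_ge0.
rewrite [leLHS](_ : _ = x `^ (q - r) * x `^ r); last first.
  by rewrite -powRD ?subrK// (gt_eqF x0) implybT.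
rewrite ler_wpM2r ?powR_ge0//.
rewrite -(opprB r q) !powRN lef_pV2 ?posrE ?powR_gt0//.
by apply: ge0_ler_powR; rewrite ?nnegrE ?subr_ge0// ltW.
Qed.

End PowerInequalities.

(** * The Dirichlet kernel *)

Section Kernel.
Variable R : realType.
Implicit Types (p q r s x u v : R) (z : R[i]).

Definition geo n z : R[i] := \sum_(k < n) z ^+ k.

Lemma geo_double n z : geo n.*2 z = (1 + z) * geo n (z ^+ 2).
Proof.
rewrite /geo; elim: n => [|n IH]; first by rewrite !big_ord0 mulr0.
rewrite doubleS !big_ord_recr /= IH mulrDr -exprM mul2n (exprS z n.*2).
by rewrite (mulrDl 1 z (z ^+ n.*2)) mul1r addrA.
Qed.

Lemma geo_telescope n z : (1 - z) * geo n z = 1 - z ^+ n.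
Proof.
by rewrite -[RHS]opprB subrX1 -mulNr opprB.
Qed.

(** The larger of u and v is at most 2, and at least 1, so that the
smaller one is at most u v. *)
Lemma sum_powR_le u v p : 0 <= u -> 0 <= v -> u ^+ 2 + v ^+ 2 = 4 -> 1 <= p ->
  u `^ p + v `^ p <= 2 `^ p + (u * v) `^ p.
Proof.
move=> + + + p1; have p0 : 0 <= p by lra.
wlog uv : u v / v <= u.
  move=> W u0 v0; have [/W|/ltW/W W'] := leP v u; first exact.
  by rewrite addrC => ?; rewrite [leLHS]addrC (mulrC u); exact: W'.
move=> u0 v0 uv4.
apply: lerD; apply: ge0_ler_powR; rewrite ?nnegrE ?mulr_ge0//; first nra.
have u1 : 1 <= u by nra.
by rewrite ler_peMl.
Qed.

Lemma EP_geo n : EP setT (fun t => geo n (ch 1 t)).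
Proof.
by apply: EP_sum => k _; apply: EPX => //; exact: EPch.
Qed.

(** Write z for ch 1 t. The kernel with 2 n terms is (1 + z) times the
kernel with n terms at z^2, and the shift by pi changes z into - z. So the sum of
|1 + z|^p + |1 - z|^p appears in front of the same factor; [sum_powR_le] bounds it
by 2^p plus a power of |1 - z^2|, which cancels the kernel down to
|1 - z^(2 n)| <= 2. *)
Lemma kernel_step n p m m' : 1 <= p ->
  has_mean (fun t => nrm (geo n (ch 1 t)) `^ p) m ->
  has_mean (fun t => nrm (geo n.*2 (ch 1 t)) `^ p) m' ->
  m' <= 2 `^ (p - 1) * (m + 1).
Proof.
move=> p1 hm hm'; have p0 : 0 <= p by lra.
have h2 := mean_affine pi (oner_neq0 R) hm'.
have k2 := mean_affine (c := 2) 0 (negbT (pnatr_eq0 R 2)) hm.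
have := le_mean (meanD hm' h2) (meanZ (2 `^ p) (meanD k2 (mean_cst 1))).
have -> : (2 : R) `^ p = 2 * 2 `^ (p - 1) by rewrite mulr_powRB1//; lra.
move=> H; suff : m' + m' <= 2 * 2 `^ (p - 1) * (m + 1) by lra.
apply: H => t; rewrite mulr_powRB1//; last lra.
rewrite mul1r addr0.
have -> : ch 1 (t + pi) = - ch 1 t.
  by rewrite /ch !mul1r cosDpi sinDpi; apply/eqP; rewrite eq_complex/= !eqxx.
have -> : ch 1 (2 * t) = ch 1 t ^+ 2 by rewrite ch_scale mul1r -chMn mulr1.
set z := ch 1 t.
rewrite !geo_double sqrrN !Normc.normcM !powRM ?nrm_ge0// -mulrDl.
set w := nrm (geo n _).
have uv4 : nrm (1 + z) ^+ 2 + nrm (1 - z) ^+ 2 = 4.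
  have : nrm z ^+ 2 = 1 by rewrite nrm_ch expr1n.
  rewrite !nrm_sqr; case: (z) => a b /=; lra.
have := sum_powR_le (nrm_ge0 _) (nrm_ge0 _) uv4 p1.
move=> /(ler_wpM2r (powR_ge0 w p)) /le_trans; apply.
rewrite mulrDl mulrDr mulr1 lerD2l -powRM ?mulr_ge0 ?nrm_ge0//.
apply: ge0_ler_powR; rewrite ?nnegrE ?mulr_ge0 ?nrm_ge0//.
rewrite -!Normc.normcM (_ : (1 + z) * (1 - z) = 1 - z ^+ 2); last ring.
rewrite geo_telescope (le_trans (le_normcD _ _))// normcN Normc.normc1 !nrmX nrm_ch !expr1n.
lra.
Qed.

Lemma kernel_means p : 1 <= p -> exists a : nat -> R,
  [/\ forall m, has_mean (fun t => nrm (geo (2 ^ m) (ch 1 t)) `^ p) (a m), a 0%N = 1 &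
   forall m, a m.+1 <= 2 `^ (p - 1) * (a m + 1)].
Proof.
move=> p1.
have [a ha] := choice (fun m => mean_nrm_powR (EP_geo (2 ^ m)) p1).
exists a; split=> // [|m]; last first.
  by apply: kernel_step (ha m) _ => //; rewrite -mul2n -expnS.
apply: mean_unique (ha 0%N) _; apply: mean_eq (mean_cst 1) _ _ => // t.
by rewrite /geo expn0 big_ord1 Normc.normc1 powR1.
Qed.

Lemma kernel_L1 m (a : R) : has_mean (fun t => nrm (geo (2 ^ m) (ch 1 t)) `^ 1) a ->
  a <= m%:R + 1.
Proof.
have [b [hb b0 bS]] := kernel_means (lexx 1).
move=> /(mean_unique (hb m)) <-; elim: m => [|m IH]; first by rewrite b0 add0r.
by rewrite (le_trans (bS m))// subrr powRr0 mul1r -natr1 lerD2r.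
Qed.

Lemma pow2_powR m x : (2 ^ m)%:R `^ x = (2 `^ x) ^+ m :> R.
Proof. by rewrite natrX -powR_mulrn// -powRrM mulrC powRrM powR_mulrn// powR_ge0. Qed.

(** For p > 1 the recursion a' <= rho (a + 1), with rho = 2^(p-1) > 1,
keeps a + D below a multiple of rho^m when D = rho / (rho - 1). *)
Lemma kernel_Lp_upper p : 1 < p -> exists2 C : R, 0 < C & forall m a,
  has_mean (fun t => nrm (geo (2 ^ m) (ch 1 t)) `^ p) a -> a <= C * (2 ^ m)%:R `^ (p - 1).
Proof.
move=> p1; have [b [hb b0 bS]] := kernel_means (ltW p1).
pose rho : R := 2 `^ (p - 1).
have rho1 : 1 < rho.
  have <- : 1 `^ (p - 1) = 1 by rewrite powR1.
  by apply: gt0_ltr_powR; rewrite ?nnegrE// ?subr_gt0// ltr1n.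
pose D := rho / (rho - 1).
have D0 : 0 < D by rewrite divr_gt0 ?subr_gt0//; lra.
have DE : rho * D = rho + D by rewrite /D; field; rewrite gt_eqF ?subr_gt0.
exists (1 + D) => [|m a]; first lra.
move=> /(mean_unique (hb m)) <-; rewrite pow2_powR -/rho.
suff : b m <= (1 + D) * rho ^+ m - D by lra.
elim: m => [|m IH]; first by rewrite b0 expr0; lra.
rewrite (le_trans (bS m))// -/rho exprS.
have : rho * b m <= rho * ((1 + D) * rho ^+ m - D) by rewrite ler_wpM2l//; lra.
lra.
Qed.

Lemma kernel_L2 n : has_mean (fun t => nrm (geo n (ch 1 t)) ^+ 2) n%:R.
Proof.
have inj : {in index_enum 'I_n &, injective (fun k : 'I_n => (k : nat)%:R : R)}.
  by move=> i j _ _ /eqP; rewrite eqr_nat => /eqP/val_inj.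
apply: mean_eq (parseval (fun=> 1) (index_enum_uniq 'I_n) inj) _ _.
  move=> t; congr (nrm _ ^+ 2); rewrite /geo; apply: eq_bigr => k _.
  by rewrite mul1r -(mulr1 k%:R) chMn.
under eq_bigr do rewrite Normc.normc1 expr1n.
by rewrite sumr_const cardE size_enum_ord.
Qed.

(** The mean of |K|^2 is N, and at most half of it comes from the
points where |K| <= k N for a small constant k, by the upper bound for the exponent
3/2. At the other points |K|^2 is at most (k N)^(2 - p) |K|^p. *)
Lemma kernel_Lp_lower p : 2 <= p -> exists2 c : R, 0 < c & forall m a,
  has_mean (fun t => nrm (geo (2 ^ m) (ch 1 t)) `^ p) a -> c * (2 ^ m)%:R `^ (p - 1) <= a.
Proof.
move=> p2; pose r : R := 3 / 2.
have r1 : 1 < r by rewrite /r; lra.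
have [C C0 HC] := kernel_Lp_upper r1.
(* this k makes (k N)^(2 - r) M|K|^r at most N / 2, half of M|K|^2 *)
pose k : R := (2 * C)^-1 ^+ 2.
have k0 : 0 < k by rewrite exprn_gt0// invr_gt0 mulr_gt0.
exists (2^-1 * (k `^ (2 - p))^-1).
  by rewrite mulr_gt0// invr_gt0 powR_gt0.
move=> m a ha.
set N : R := (2 ^ m)%:R.
have N0 : 0 < N by rewrite /N ltr0n expn_gt0.
have kN : 0 < k * N by rewrite mulr_gt0.
have [b hb] := mean_nrm_powR (EP_geo (2 ^ m)) (ltW r1).
have bC := HC _ _ hb.
have : N <= (k * N) `^ (2 - r) * b + (k * N) `^ (2 - p) * a.
  apply: le_mean (kernel_L2 (2 ^ m)) (meanD (meanZ _ hb) (meanZ _ ha)) _ => t.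
  rewrite -powR_mulrn ?nrm_ge0//; apply: powR_interp => //; rewrite ?nrm_ge0// /r; lra.
have -> : (k * N) `^ (2 - r) = (2 * C)^-1 * N `^ 2^-1.
  have -> : 2 - r = 2^-1 by rewrite /r; field.
  rewrite powRM ?(ltW k0) ?(ltW N0)// powR12_sqrt ?(ltW k0)// /k.
  by rewrite sqrtr_sqr ger0_norm ?invr_ge0 ?mulr_ge0 ?(ltW C0).
have : (2 * C)^-1 * N `^ 2^-1 * b <= N / 2.
  have : (2 * C)^-1 * N `^ 2^-1 * b <= (2 * C)^-1 * N `^ 2^-1 * (C * N `^ (r - 1)).
    by rewrite ler_wpM2l// mulr_ge0 ?powR_ge0// invr_ge0 mulr_ge0 ?ltW.
  move=> /le_trans; apply.
  have -> : r - 1 = 2^-1 by rewrite /r; field.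
  rewrite powR12_sqrt ?(ltW N0)// -[in leRHS](sqr_sqrtr (ltW N0)).
  rewrite le_eqVlt; apply/orP; left; apply/eqP; field; rewrite gt_eqF//.
move=> H1 H2; have {H1 H2} : N / 2 <= (k * N) `^ (2 - p) * a by lra.
rewrite powRM ?(ltW k0) ?(ltW N0)// => H.
have Kp : 0 < k `^ (2 - p) by rewrite powR_gt0.
have Np : 0 < N `^ (p - 2) by rewrite powR_gt0.
have E1 : N `^ (2 - p) * N `^ (p - 2) = 1.
  rewrite -(@powRD _ N); last by rewrite (gt_eqF N0) implybT.
  have -> : 2 - p + (p - 2) = 0 by ring.
  by rewrite powRr0.
have E2 : N `^ (p - 1) = N * N `^ (p - 2).
  have -> : p - 1 = 1 + (p - 2) by ring.
  rewrite (@powRD _ N 1); last by rewrite (gt_eqF N0) implybT.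
  by rewrite powRr1// ltW.
rewrite E2 -(ler_pM2l Kp).
have : N / 2 * N `^ (p - 2) <= k `^ (2 - p) * N `^ (2 - p) * a * N `^ (p - 2).
  by rewrite ler_wpM2r// ltW.
have -> : k `^ (2 - p) * N `^ (2 - p) * a * N `^ (p - 2) =
  k `^ (2 - p) * a * (N `^ (2 - p) * N `^ (p - 2)) by ring.
rewrite E1 mulr1; apply: le_trans.
rewrite le_eqVlt; apply/orP; left; apply/eqP; field; rewrite gt_eqF//.
Qed.

End Kernel.

(** * Sparse sets of frequencies *)

Section Sparse.
Variable R : realType.
Implicit Types (L mu : R) (F : R -> R[i]) (lam : nat -> R).

Lemma EP_ballX L F i : EP [set x | `|x| <= L] F ->
  EP [set x | `|x| <= i%:R * L] (fun t => F t ^+ i).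
Proof.
move=> LF; elim: i => [|i IH].
  by apply: EP_eq (EP_cst 1 _) _ => [|t]; rewrite /= ?normr0 ?mul0r ?expr0.
apply: EP_eq (EPM _ LF IH) _ => [x y /= xL yL|t]; last by rewrite exprS.
rewrite (le_trans (ler_normD _ _))// mulrS mulrDl mul1r; exact: lerD.
Qed.

(** In the binomial expansion of (ch mu + F)^j the terms have spectra near
different multiples of mu, which are disjoint when mu is large, so their means of
squares add up. *)
Lemma sparse_step M L mu F (a : nat -> R) : 0 <= L -> 2 * M%:R * L < mu ->
  EP [set x | `|x| <= L] F ->
  (forall j, (j <= M)%N -> has_mean (fun t => nrm (F t ^+ j) ^+ 2) (a j)) ->
  forall j, (j <= M)%N -> has_mean (fun t => nrm ((ch mu t + F t) ^+ j) ^+ 2)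
    (\sum_(i < j.+1) ('C(j, i))%:R ^+ 2 * a i).
Proof.
move=> L0 Lmu LF Fa j jM.
pose G i t := ('C(j, i))%:R%:C * ch ((j - i)%:R * mu) t * F t ^+ i.
pose S i := [set x : R | `|x - (j - i)%:R * mu| <= i%:R * L].
apply: mean_eq (@mean_orthogonal_sum _ j.+1 G S (fun i => ('C(j, i))%:R ^+ 2 * a i) _ _ _) _ _ => //.
- move=> i k x /andP[ik kj]; rewrite /S /= !ler_distl => /andP[+ _] /andP[_ +].
  rewrite ltnS in kj.
  have ij : (i <= j)%N by exact: leq_trans (ltnW ik) kj.
  rewrite !natrB//.
  have ik1 : 1 <= k%:R - i%:R :> R by rewrite -natrB ?(ltnW ik)// ler1n subn_gt0.
  have iM : i%:R <= M%:R :> R by rewrite ler_nat (leq_trans ij).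
  have kM : k%:R <= M%:R :> R by rewrite ler_nat (leq_trans kj).
  have mu0 : 0 <= mu by apply: le_trans (ltW Lmu); rewrite !mulr_ge0.
  have : mu <= (k%:R - i%:R) * mu by rewrite ler_peMl.
  have : i%:R * L <= M%:R * L by rewrite ler_wpM2r.
  have : k%:R * L <= M%:R * L by rewrite ler_wpM2r.
  lra.
- move=> i ij; apply: EPZch (EP_ballX i LF) => v; rewrite /S /=.
  by rewrite addrC addKr.
- move=> i; rewrite ltnS => ij.
  apply: mean_eq (meanZ (('C(j, i))%:R ^+ 2) (Fa i (leq_trans ij jM))) _ _ => // t.
  by rewrite /G !Normc.normcM nrm_ch mulr1 nrm_real ger0_norm// exprMn.
- move=> t /=; congr (nrm _ ^+ 2); rewrite exprDn; apply: eq_bigr => i _.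
  by rewrite /G chMn rmorph_nat -[RHS]mulr_natl mulrA.
Qed.

(** Each coefficient satisfies C(j, i) i! <= j!, and what remains is the
binomial expansion of (1 + N)^j. *)
Lemma sparse_count j (N : R) : 0 <= N ->
  \sum_(i < j.+1) ('C(j, i))%:R ^+ 2 * ((i`!)%:R * N ^+ i) <= (j`!)%:R * (1 + N) ^+ j.
Proof.
move=> N0; rewrite exprDn mulr_sumr; apply: ler_sum => i _.
rewrite expr1n mul1r expr2 -[X in _ <= _ * X]mulr_natl.
have : ('C(j, i))%:R * (i`!)%:R <= (j`!)%:R :> R.
  rewrite -natrM ler_nat.
  have ij : (i <= j)%N by rewrite -ltnS.
  by rewrite -(bin_fact ij) leq_mul2l leq_pmulr ?fact_gt0 ?orbT.
move=> /(ler_wpM2r (mulr_ge0 (ler0n R 'C(j, i)) (exprn_ge0 i N0))); apply: le_trans.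
rewrite le_eqVlt; apply/orP; left; apply/eqP; ring.
Qed.

(** The set is built one element at a time, each new frequency being chosen
large compared with the previous ones, as the frequency is unbounded. *)
Lemma sparse_sets lam M N : is_frequency lam ->
  exists A : {fset nat}, #|` A| = N /\ forall j, (j <= M)%N -> exists2 a,
    has_mean (fun t => nrm ((\sum_(n <- A) ch (lam n) t) ^+ j) ^+ 2) a &
    a <= (j`!)%:R * N%:R ^+ j.
Proof.
move=> [lam0 lammono lamoo].
suff : exists A : {fset nat}, exists2 L, [/\ 0 <= L, #|` A| = N,
    forall n, n \in A -> lam n <= L &
    EP [set x | `|x| <= L] (fun t => \sum_(n <- A) ch (lam n) t)] &
  exists a : nat -> R, forall j, (j <= M)%N ->
    has_mean (fun t => nrm ((\sum_(n <- A) ch (lam n) t) ^+ j) ^+ 2) (a j) /\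
    a j <= (j`!)%:R * N%:R ^+ j.
  move=> [A [L [_ AN _ _] [a ha]]]; exists A; split=> // j jM.
  by have [? ?] := ha j jM; exists (a j).
elim: N => [|N [A [L [L0 AN AL LF] [a ha]]]].
  exists fset0%fset, 0; first split=> //.
    by apply: EP_eq (EP0 _) _ => t; rewrite big_nil.
  exists (fun j => 0 ^+ j) => j _; split; last first.
    by rewrite ler_peMl ?exprn_ge0// ler1n fact_gt0.
  apply: mean_eq (mean_cst (0 ^+ j)) _ _ => // t.
  by rewrite big_nil nrmX Normc.normc0 !expr0n; case: eqP => _; rewrite ?expr1n ?expr0n.
have [n nL] := lamoo (Num.max L (2 * M%:R * L)).
rewrite gt_max in nL; case/andP: nL => nL nML.
have nA : n \notin A by apply: contraTN nL => /AL; rewrite leNgt.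
have E t : \sum_(k <- (n |` A)%fset) ch (lam k) t = ch (lam n) t + \sum_(k <- A) ch (lam k) t.
  by rewrite big_fsetU1.
exists (n |` A)%fset, (lam n); first split=> //.
- by rewrite cardfsU1 nA AN.
- by move=> k; rewrite in_fset1U => /predU1P[->//|/AL kL]; exact/ltW/(le_lt_trans kL).
- rewrite (funext E); apply: EPD; first by apply: EPch; rewrite /= ger0_norm.
  by apply: EP_sub LF => x /= xL; exact/ltW/(le_lt_trans xL).
exists (fun j => \sum_(i < j.+1) ('C(j, i))%:R ^+ 2 * a i) => j jM; split.
  apply: mean_eq (sparse_step L0 nML LF (fun j jM => (ha j jM).1) jM) _ _ => // t.
  by rewrite E.
rewrite -natr1 [_ + 1]addrC; apply: le_trans (sparse_count j (ler0n R N)).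
apply: ler_sum => i _; apply: ler_wpM2l; first exact: sqr_ge0.
by apply: (ha i _).2; rewrite (leq_trans _ jM)// -ltnS.
Qed.

End Sparse.

(** * Arithmetic progressions and Rudin-Shapiro coefficients *)

Section Progressions.
Variable R : realType.
Implicit Types (lam : nat -> R).

Lemma normE (z : R[i]) : `|z| = (nrm z)%:C.
Proof. by rewrite normc_def; case: z. Qed.

(** The sum over such a set is, up to a unimodular factor and a dilation,
a polynomial in ch 1 t, and the coefficients can be prescribed along the
progression. *)
Lemma progression_sets lam N : is_frequency lam -> has_large_APs lam ->
  exists (A : {fset nat}) (nu : nat -> nat) (w b : R),
  [/\ #|` A| = N, 0 < b,
      forall a t, \sum_(n <- A) a n * ch (lam n) t =
                  ch w t * \sum_(k < N) a (nu k) * ch 1 (b * t) ^+ k &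
      forall r : nat -> R[i], exists eps : nat -> R[i],
        (forall n, n \in A -> exists k, eps n = r k) /\
        forall k, (k < N)%N -> eps (nu k) = r k].
Proof.
move=> [_ lammono _] /(_ N) [w [b [b0 Hk]]].
have /choice[nu0 Hnu0] : forall k : nat, exists n, (1 <= k <= N)%N -> lam n = w + k%:R * b.
  move=> k; have [/Hk[n Hn]|_] := boolP (1 <= k <= N)%N; first by exists n.
  by exists 0%N.
pose nu k := nu0 k.+1.
have Hnu k : (k < N)%N -> lam (nu k) = (w + b) + k%:R * b.
  by move=> kN; rewrite Hnu0 ?ltnS// -natr1; ring.
have nuI : {in iota 0 N &, injective nu}.
  move=> k l; rewrite !mem_iota !add0n => kN lN kl.
  have : k%:R * b = l%:R * b by apply: (@addrI _ (w + b)); rewrite -!Hnu// kl.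
  by move/(mulIf (lt0r_neq0 b0))/eqP; rewrite eqr_nat => /eqP.
pose s := map nu (iota 0 N).
have us : uniq s by rewrite map_inj_in_uniq ?iota_uniq.
have ps := seq_fset_perm tt s; rewrite undup_id// in ps.
exists (seq_fset tt s), nu, (w + b), b; split=> //.
- by rewrite /= (perm_size ps) size_map size_iota.
- move=> a t; rewrite (perm_big _ ps)/= /s big_map -{1}(subn0 N).
  rewrite -/(index_iota 0 N) big_mkord mulr_sumr.
  apply: eq_bigr => k _.
  by rewrite Hnu// chD chMn ch_scale mul1r; ring.
- move=> r; exists (fun n => r (index n s)); split=> [n _|k kN]; first by exists (index n s).
  have ks : (k < size s)%N by rewrite size_map size_iota.
  have -> : nu k = nth 0%N s k by rewrite (nth_map 0%N) ?size_iota// nth_iota.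
  by rewrite index_uniq.
Qed.

(** Two polynomials P and Q of length N are replaced by P + z^N Q and
P - z^N Q. By the parallelogram law |P|^2 + |Q|^2 doubles, like the length. *)
Lemma rudin_shapiro m : exists r : nat -> R[i], (forall k, nrm (r k) = 1) /\
  forall z : R[i], nrm z = 1 ->
    nrm (\sum_(k < 2 ^ m) r k * z ^+ k) ^+ 2 <= 2 * (2 ^ m)%:R.
Proof.
suff [r [s [r1 s1 H]]] : exists r s : nat -> R[i], [/\ forall k, nrm (r k) = 1,
    forall k, nrm (s k) = 1 & forall z : R[i], nrm z = 1 ->
    nrm (\sum_(k < 2 ^ m) r k * z ^+ k) ^+ 2 +
    nrm (\sum_(k < 2 ^ m) s k * z ^+ k) ^+ 2 = 2 * (2 ^ m)%:R].
  by exists r; split=> // z /H <-; rewrite lerDl sqr_ge0.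
elim: m => [|m [r [s [r1 s1 H]]]].
  exists (fun=> 1), (fun=> 1); split=> [k|k|z z1]; rewrite ?Normc.normc1//.
  by rewrite expn0 !big_ord1 expr0 mulr1 Normc.normc1 expr1n; lra.
pose N := (2 ^ m)%N; pose glue (u v : nat -> R[i]) k := if (k < N)%N then u k else v (k - N)%N.
have glueE u v z : \sum_(k < 2 ^ m.+1) glue u v k * z ^+ k =
    \sum_(k < N) u k * z ^+ k + z ^+ N * \sum_(k < N) v k * z ^+ k.
  rewrite expnS mul2n -addnn big_split_ord /=; congr (_ + _).
    by apply: eq_bigr => k _; rewrite /glue ltn_ord.
  rewrite mulr_sumr; apply: eq_bigr => k _.
  by rewrite /glue ltnNge leq_addr /= addKn exprD; ring.
exists (glue r s), (glue r (fun k => - s k)); split=> [k|k|z z1].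
- by rewrite /glue; case: ifP.
- by rewrite /glue; case: ifP => // _; rewrite normcN.
rewrite !glueE.
have -> : \sum_(k < N) - s k * z ^+ k = - \sum_(k < N) s k * z ^+ k.
  by rewrite -sumrN; apply: eq_bigr => k _; rewrite mulNr.
have := H z z1; rewrite -/N; set P := \sum_(k < N) _; set Q := \sum_(k < N) _ => PQ.
have -> : nrm (P + z ^+ N * Q) ^+ 2 + nrm (P + z ^+ N * - Q) ^+ 2 =
    2 * (nrm P ^+ 2 + nrm (z ^+ N * Q) ^+ 2).
  rewrite mulrN; set y := z ^+ N * Q.
  by rewrite !nrm_sqr; case: (P) (y) => [a b] [c d] /=; ring.
by rewrite Normc.normcM nrmX z1 expr1n mul1r PQ expnS natrM.
Qed.

End Progressions.

(** * The Littlewood inequality *)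

Section Littlewood.
Variable R : realType.
Implicit Types (f F : R -> R[i]) (w : nat -> R) (a : nat -> R[i]).

Lemma nrm_expB1 (u : R[i]) K : nrm u <= 1 -> nrm (u ^+ K - 1) <= K%:R * nrm (u - 1).
Proof.
move=> u1; elim: K => [|K IH]; first by rewrite subrr Normc.normc0 mul0r.
rewrite (_ : u ^+ K.+1 - 1 = u * (u ^+ K - 1) + (u - 1)); last by rewrite exprS; ring.
rewrite (le_trans (le_normcD _ _))// mulrS mulrDl mul1r [leRHS]addrC lerD2r.
by rewrite Normc.normcM (le_trans _ IH)// ler_piMl ?nrm_ge0.
Qed.

(** The K-th power of 1 - z / K behaves like exp(- z), but it is a
polynomial in z, which is what keeps spectra under control. The slack e in the
lower bound of the real part absorbs the quadratic term once K is large; then all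
factors have modulus at most 1, which gives the second bound by telescoping. *)
Lemma damping_bound (z : R[i]) (x e : R) K : (0 < K)%N -> 0 < e -> 0 <= x ->
  x + e <= complex.Re z -> nrm z ^+ 2 <= e * K%:R ->
  let u := 1 - K%:R^-1%:C * z in
  nrm (u ^+ K) * (1 + x) <= 1 /\ nrm (u ^+ K - 1) <= nrm z.
Proof.
move=> K0 e0 x0 xz zK u.
have K0' : 0 < K%:R :> R by rewrite ltr0n.
have u2 : nrm u ^+ 2 <= 1 - 2 * x / K%:R.
  have -> : nrm u ^+ 2 = 1 - (2 * complex.Re z - nrm z ^+ 2 / K%:R) / K%:R.
    rewrite /u !nrm_sqr; case: (z) => b c /=; field; exact: lt0r_neq0.
  rewrite lerD2l lerN2 ler_pM2r ?invr_gt0//.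
  have : nrm z ^+ 2 / K%:R <= e by rewrite ler_pdivrMr.
  lra.
have u1 : nrm u <= 1.
  rewrite -(@expr_le1 _ 2) ?nrm_ge0// (le_trans u2)//.
  by rewrite gerBl divr_ge0 ?mulr_ge0// ltW.
split.
  have ux : nrm u ^+ 2 <= expR (- (2 * x / K%:R)).
    exact: le_trans u2 (expR_ge1Dx _).
  have E2 : nrm (u ^+ K) ^+ 2 <= expR (- x) ^+ 2.
    rewrite nrmX -exprM mulnC exprM -expRM_natl.
    have -> : 2 * - x = K%:R * (- (2 * x / K%:R)) by field; exact: lt0r_neq0.
    by rewrite expRM_natl lerXn2r// ?nnegrE ?sqr_ge0 ?expR_ge0.
  have {}E2 : nrm (u ^+ K) <= expR (- x).
    by rewrite -(@ler_pXn2r _ 2)// nnegrE ?nrm_ge0 ?expR_ge0.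
  rewrite (le_trans (_ : _ <= expR (- x) * (1 + x)))//.
    by rewrite ler_wpM2r// addr_ge0.
  rewrite expRN mulrC ler_pdivrMr ?expR_gt0// mul1r; exact: expR_ge1Dx.
apply: le_trans (nrm_expB1 K u1) _.
have -> : u - 1 = - (K%:R^-1%:C * z) by rewrite /u; ring.
rewrite normcN Normc.normcM nrm_real ger0_norm ?invr_ge0 ?(ltW K0')//.
by rewrite mulrA (mulfV (lt0r_neq0 K0')) mul1r.
Qed.

(** The polynomial h is the analytic completion of a trigonometric polynomial g
slightly above |f|. As h - c has negative spectrum, the mean of h^2 is
c^2 >= 0; hence the imaginary part of h has no larger mean square than g, and the
mean of |h|^2 is at most twice that of g^2. *)
Lemma damping S f (v e : R) : EP S f -> (forall t, nrm (f t) <= 1) ->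
  has_mean (fun t => nrm (f t) ^+ 2) v -> 0 < e ->
  exists E h m, [/\ EP [set x : R | x <= 0] E,
    forall t, nrm (E t) * (1 + nrm (f t)) <= 1,
    forall t, nrm (E t - 1) <= nrm (h t),
    has_mean (fun t => nrm (h t) ^+ 2) m & m <= 2 * v + e].
Proof.
move=> Sf f1 hv e0.
(* (|f| + 3 eta)^2 <= |f|^2 + 15 eta as |f|, eta <= 1, and this mean gets doubled *)
pose eta : R := Num.min 1 (e / 30).
have eta0 : 0 < eta by rewrite lt_min ltr01 divr_gt0.
have eta1 : eta <= 1 by rewrite ge_min lexx.
have etae : 30 * eta <= e.
  have : eta <= e / 30 by rewrite ge_min lexx orbT.
  lra.
have [q tq fq] := nrm_powR_approx Sf (lexx 1) eta0.
pose g t := q t + 2 * eta.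
have tg : trig g by apply: trigD => //; exact: trig_cst.
have fg t : nrm (f t) + eta <= g t <= nrm (f t) + 3 * eta.
  have := fq t; rewrite powRr1 ?nrm_ge0// /g ler_distl; lra.
have [c [H [SH gH]]] := trig_analytic tg.
pose h t := c%:C + H t.
have hg t : complex.Re (h t) = g t by rewrite gH /h ReD.
have Sh : EP [set x : R | x <= 0] h.
  apply: EPD; first by apply: EP_cst => /=.
  by apply: EP_sub SH => x /= /ltW.
have [mg hmg] := trig_mean (trigX 2 tg).
have hH : has_mean (fun t => complex.Re (2 * c%:C * H t + H t ^+ 2)) 0.
  apply: (@EP_mean0 _ [set x : R | x < 0]); first by rewrite /= ltxx.
  apply: EPD; first exact: EPZ.
  apply: EP_eq (EPM _ SH SH) _ => [x y /= x0 y0|t]; [lra|by rewrite expr2].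
have hmh : has_mean (fun t => nrm (h t) ^+ 2) (2 * mg - c ^+ 2).
  apply: mean_eq (meanD (meanD (meanZ 2 hmg) (meanZ (-1) hH)) (mean_cst (- c ^+ 2))) _ _.
    move=> t; rewrite gH nrm_sqr /h; case: (H t) => x y /=; ring.
  by rewrite mulr0 addr0.
have mgv : mg <= v + 15 * eta.
  apply: (le_mean hmg (meanD hv (mean_cst (15 * eta)))) => t.
  have := fg t; have := f1 t; have := nrm_ge0 (f t); nra.
have [B B0 hB] := EP_bounded Sh.
(* K is large enough to absorb the quadratic term of the factors 1 - h / K *)
pose K := (Num.truncn (B ^+ 2 / eta)).+1.
have BK : B ^+ 2 <= eta * K%:R.
  by rewrite mulrC -ler_pdivrMr// ltW// truncnS_gt.
have D t := @damping_bound (h t) (nrm (f t)) eta K isT eta0 (nrm_ge0 _).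
have hD t : nrm (f t) + eta <= complex.Re (h t) by rewrite hg; case/andP: (fg t).
have hB2 t : nrm (h t) ^+ 2 <= eta * K%:R.
  by apply: le_trans BK; rewrite ler_pXn2r ?nnegrE ?nrm_ge0// ltW.
exists (fun t => (1 - K%:R^-1%:C * h t) ^+ K), h, (2 * mg - c ^+ 2); split=> //.
- apply: EPX => /= [//|x y x0 y0|]; first lra.
  by apply: EPB; [apply: EP_cst; rewrite /= lexx|exact: EPZ].
- by move=> t; have [] := D t (hD t) (hB2 t).
- by move=> t; have [] := D t (hD t) (hB2 t).
- have := sqr_ge0 c; lra.
Qed.

Definition psum w a n t : R[i] := \sum_(k < n) a k * ch (w k) t.

(** The half-line up to the largest of the first n frequencies. A polynomial
with this spectrum is orthogonal to every sum over later indices. *)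
Definition below w n : set R := [set x | exists2 k, (k < n)%N & x <= w k].

Lemma EP_psum w a n S : (forall k, (k < n)%N -> S (w k)) -> EP S (psum w a n).
Proof. by move=> Sw; apply: EP_lincomb => k _; exact: Sw. Qed.

Lemma psum_mean w a n : (forall k l, (k < l < n)%N -> w k < w l) ->
  (forall k, (k < n)%N -> nrm (a k) = 1) ->
  has_mean (fun t => nrm (psum w a n t) ^+ 2) n%:R.
Proof.
move=> winc a1.
have inj : {in index_enum 'I_n &, injective (fun k : 'I_n => w k)}.
  move=> i j _ _ /= wij; apply/val_inj; case: (ltngtP (i : nat) j) => // lt.
    by have := winc i j; rewrite lt ltn_ord wij ltxx => /(_ isT).
  by have := winc j i; rewrite lt ltn_ord wij ltxx => /(_ isT).
apply: mean_eq (parseval (fun k : 'I_n => a k) (index_enum_uniq 'I_n) inj) _ _ => //.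
under eq_bigr do rewrite a1// expr1n.
by rewrite sumr_const cardE size_enum_ord.
Qed.

Lemma psum_cat w a n m t : psum w a (n + m) t =
  psum w a n t + psum (fun k => w (n + k)%N) (fun k => a (n + k)%N) m t.
Proof. by rewrite /psum big_split_ord. Qed.

Lemma nrm_psum_le w a n t : (forall k, (k < n)%N -> nrm (a k) = 1) ->
  nrm (psum w a n t) <= n%:R.
Proof.
elim: n => [|n IH] a1; first by rewrite /psum big_ord0 Normc.normc0.
rewrite /psum big_ord_recr /= (le_trans (le_normcD _ _))//.
rewrite Normc.normcM nrm_ch a1// mulr1 -natr1 lerD2r.
by apply: IH => k kn; apply: a1; exact: leqW.
Qed.

(** The new test polynomial is F E + f, where f is the sum over the
next 64 n terms divided by their number and E is its damping factor. The bound 2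
survives because |E| (1 + |f|) <= 1 and |f| <= 1. In the pairing with the longer
sum, f against its own block gives 1, the spectra kill the two other cross terms,
and F (E - 1) against the sum Q of the first n terms costs at most the mean of
2 |Q| |h|, with the polynomial h of [damping]. The block is 64 times longer than Q,
which makes this cost at most 1/2. *)
Lemma littlewood_step w a n F c :
  (forall k l, (k < l < n + 64 * n)%N -> w k < w l) ->
  (forall k, (k < n + 64 * n)%N -> nrm (a k) = 1) -> (0 < n)%N ->
  EP (below w n) F -> (forall t, nrm (F t) <= 2) ->
  has_mean (fun t => complex.Re (psum w a n t * (F t)^*%C)) c ->
  exists F' c', [/\ EP (below w (n + 64 * n)) F', forall t, nrm (F' t) <= 2,
    has_mean (fun t => complex.Re (psum w a (n + 64 * n) t * (F' t)^*%C)) c' &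
    c + 2^-1 <= c'].
Proof.
move=> winc a1 n0 SF F2 hc; set L := (64 * n)%N.
have n0' : 0 < n%:R :> R by rewrite ltr0n.
have LE : L%:R = 64 * n%:R :> R by rewrite /L natrM.
have L0 : 0 < L%:R :> R by rewrite LE mulr_gt0.
pose w' k := w (n + k)%N; pose a' k := a (n + k)%N.
pose P := psum w' a' L; pose Q := psum w a n.
pose f t := L%:R^-1%:C * P t.
have w'inc k l : (k < l < L)%N -> w' k < w' l.
  by move=> /andP[kl lL]; apply: winc; rewrite !ltn_add2l kl.
have a'1 k : (k < L)%N -> nrm (a' k) = 1.
  by move=> kL; apply: a1; rewrite ltn_add2l.
have hP : has_mean (fun t => nrm (P t) ^+ 2) L%:R by exact: psum_mean.
have hQ : has_mean (fun t => nrm (Q t) ^+ 2) n%:R.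
  apply: psum_mean => [k l /andP[kl ln]|k kn].
    by apply: winc; rewrite kl ltn_addr.
  by apply: a1; rewrite ltn_addr.
pose V : set R := [set x | exists2 k, (k < L)%N & x = w' k].
have SP : EP V P by apply: EP_psum => k kL; exists k.
have Sf : EP V f by exact: EPZ.
have SQ : EP (below w n) Q by apply: EP_psum => k kn; exists k.
have fE t : nrm (f t) = L%:R^-1 * nrm (P t).
  by rewrite /f Normc.normcM nrm_real ger0_norm// invr_ge0 ltW.
have f1 t : nrm (f t) <= 1.
  rewrite fE mulrC ler_pdivrMr// mul1r; exact: nrm_psum_le.
have hf : has_mean (fun t => nrm (f t) ^+ 2) L%:R^-1.
  apply: mean_eq (meanZ (L%:R^-1 ^+ 2) hP) _ _.
    by move=> t; rewrite fE exprMn.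
  by rewrite expr2 -mulrA mulVf ?mulr1// gt_eqF.
have e0 : 0 < 2 / L%:R :> R by rewrite divr_gt0.
have [E [h [m [SE Ef Eh hm mle]]]] := damping Sf f1 hf e0.
have belowV x y : below w n x -> V y -> x < y.
  move=> [k kn xk] [l lL ->]; apply: le_lt_trans xk _.
  by apply: winc; rewrite ltn_addr// ltn_add2l.
have SFE : EP (below w n) (fun t => F t * E t).
  apply: EPM SF SE => x y [k kn xk] /= y0; exists k => //; lra.
have subB : forall x, below w n x -> below w (n + L) x.
  by move=> x [k kn xk]; exists k => //; rewrite ltn_addr.
pose F' t := F t * E t + f t.
have SF' : EP (below w (n + L)) F'.
  apply: EPD; first exact: EP_sub SFE.
  by apply: EP_sub Sf => x [k kL ->]; exists (n + k)%N => //; rewrite ltn_add2l.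
have F'2 t : nrm (F' t) <= 2.
  rewrite (le_trans (le_normcD _ _))// Normc.normcM.
  have := Ef t; have := F2 t; have := f1 t; have := nrm_ge0 (f t).
  have := nrm_ge0 (E t); have := nrm_ge0 (F t).
  move: (nrm (f t)) (nrm (E t)) (nrm (F t)) => x y z z0 y0 x0 x1 z2 yx.
  have : z * y <= 2 * y by rewrite ler_wpM2r.
  suff : 2 * y <= 2 - x by lra.
  by rewrite -(@ler_pM2r _ (1 + x)) ?ltr_wpDr//; nra.
have [c' hc'] : exists c', has_mean (fun t => complex.Re (psum w a (n + L) t * (F' t)^*%C)) c'.
  apply: (@EP_mean _ setT); apply: (@EPM _ setT setT) => //.
    exact: EP_psum.
  by apply: (@EPJ _ setT) => //; exact: EP_sub SF'.
exists F', c'; split=> //.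
have hQf := mean_cross0 (fun x y Sx Vy => negbT (lt_eqF (belowV x y Sx Vy))) SQ Sf.
have hPFE := mean_cross0 (fun x y Vx Sy => negbT (gt_eqF (belowV y x Sy Vx))) SP SFE.
(* 2 |Q| |h| <= th |Q|^2 + |h|^2 / th, where M|Q|^2 = n and M|h|^2 <= 4 / (64 n):
   this weight makes both means equal to 1/4 *)
pose th : R := (4 * n%:R)^-1.
have th0 : 0 < th by rewrite invr_gt0 mulr_gt0.
have := le_mean (meanD (meanD (meanD hc hQf) (meanD hPFE (meanZ L%:R^-1 hP)))
  (meanD (meanZ (- th) hQ) (meanZ (- th^-1) hm))) hc'.
rewrite mulVf ?gt_eqF// addr0 add0r => H.
have {H} : c + 1 + (- th * n%:R + - th^-1 * m) <= c'.
  apply: H => t; rewrite psum_cat -/w' -/a' -/P -/Q.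
  rewrite -/(P t) -/(Q t).
  have -> : complex.Re ((Q t + P t) * (F' t)^*%C) =
     complex.Re (Q t * (F t)^*%C) + complex.Re (Q t * (f t)^*%C) +
     (complex.Re (P t * (F t * E t)^*%C) + L%:R^-1 * nrm (P t) ^+ 2) +
     complex.Re (Q t * (F t * (E t - 1))^*%C).
    rewrite nrm_sqr /F' /f; case: (Q t) (P t) (F t) (E t) => [x1 y1] [x2 y2] [x3 y3] [x4 y4] /=.
    ring.
  rewrite lerD2l.
  have : complex.Re (- Q t * (F t * (E t - 1))^*%C) <= nrm (Q t) * (2 * nrm (h t)).
    rewrite (le_trans (Re_le_nrm _))// Normc.normcM normcN nrmJ Normc.normcM.
    by rewrite ler_wpM2l ?nrm_ge0// ler_pM ?nrm_ge0.
  have -> : complex.Re (- Q t * (F t * (E t - 1))^*%C) = - complex.Re (Q t * (F t * (E t - 1))^*%C).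
    by rewrite mulNr; case: (_ * _).
  have : nrm (Q t) * (2 * nrm (h t)) <= th * nrm (Q t) ^+ 2 + th^-1 * nrm (h t) ^+ 2.
    rewrite -subr_ge0 (_ : _ - _ = th^-1 * (th * nrm (Q t) - nrm (h t)) ^+ 2).
      by rewrite mulr_ge0 ?sqr_ge0 ?invr_ge0 ?(ltW th0).
    by field; exact: lt0r_neq0.
  lra.
have -> : - th * n%:R = - 4^-1 by rewrite /th; field; exact: lt0r_neq0.
have : th^-1 * m <= 4^-1.
  have -> : 4^-1 = th^-1 * (2 * L%:R^-1 + 2 / L%:R).
    by rewrite /th LE; field; exact: lt0r_neq0.
  by rewrite ler_wpM2l ?invr_ge0 ?(ltW th0).
lra.
Qed.

Lemma littlewood_dual w a N J :
  (forall k l, (k < l < N)%N -> w k < w l) ->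
  (forall k, (k < N)%N -> nrm (a k) = 1) -> (65 ^ J <= N)%N ->
  exists F c, [/\ EP (below w (65 ^ J)) F, forall t, nrm (F t) <= 2,
    has_mean (fun t => complex.Re (psum w a (65 ^ J) t * (F t)^*%C)) c &
    1 + J%:R / 2 <= c].
Proof.
move=> winc a1; elim: J => [|J IH] JN.
  exists (fun t => a 0%N * ch (w 0%N) t), 1; split.
  - by apply: EPZ; apply: EPch; exists 0%N.
  - by move=> t; rewrite Normc.normcM nrm_ch a1// mulr1; lra.
  - apply: mean_eq (mean_cst 1) _ _ => // t.
    by rewrite expn0 /psum big_ord1 /= -nrm_sqrE Normc.normcM nrm_ch a1// mulr1 expr1n.
  - by rewrite mul0r addr0.
have E : (65 ^ J.+1 = 65 ^ J + 64 * 65 ^ J)%N by rewrite expnS -mulSn.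
have JN' : (65 ^ J <= N)%N by apply: leq_trans JN; rewrite E leq_addr.
have [F [c [SF F2 hc c1]]] := IH JN'.
have [|||F' [c' [SF' F'2 hc' cc']]] := littlewood_step _ _ _ SF F2 hc.
- by move=> k l /andP[kl lJ]; apply: winc; rewrite kl (leq_trans lJ)// -E.
- by move=> k kJ; apply: a1; rewrite (leq_trans kJ)// -E.
- by rewrite expn_gt0.
exists F', c'; rewrite E; split=> //; rewrite -natr1; lra.
Qed.

(** Pairing the sum with the bounded test polynomial, where the terms
of index at least 65^J do not contribute. *)
Lemma littlewood : exists2 C : R, 0 < C & forall w a N m,
  (forall k l, (k < l < N)%N -> w k < w l) ->
  (forall k, (k < N)%N -> nrm (a k) = 1) -> (0 < N)%N ->
  has_mean (fun t => nrm (psum w a N t) `^ 1) m -> C * ln N%:R <= m.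
Proof.
have l65 : 0 < ln 65 :> R by rewrite ln_gt0// ltr1n.
exists (4 * ln 65)^-1; first by rewrite invr_gt0 mulr_gt0.
move=> w a N m winc a1 N0 hm; pose J := trunc_log 65 N.
have JN : (65 ^ J <= N)%N by exact: trunc_logP.
have NJ : (N < 65 ^ J.+1)%N by exact: trunc_log_ltn.
have [F [c [SF F2 hc c1]]] := littlewood_dual winc a1 JN.
pose n := (65 ^ J)%N.
pose P := psum (fun k => w (n + k)%N) (fun k => a (n + k)%N) (N - n)%N.
have hP : has_mean (fun t => complex.Re (P t * (F t)^*%C)) 0.
  apply: (@mean_cross0 _ [set x | exists2 k, (k < N - n)%N & x = w (n + k)%N]) SF.
    move=> x y [k kN ->] [l ln yl]; rewrite gt_eqF// (le_lt_trans yl)//.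
    by apply: winc; rewrite ltn_addr// -ltn_subRL.
  by apply: EP_psum => k kN; exists k.
have : c + 0 <= 2 * m.
  apply: le_mean (meanD hc hP) (meanZ 2 hm) _ => t.
  rewrite -ReD -mulrDl -psum_cat subnKC// powRr1 ?nrm_ge0//.
  rewrite (le_trans (Re_le_nrm _))// Normc.normcM nrmJ mulrC.
  by rewrite ler_wpM2r ?nrm_ge0.
have : (ln N%:R : R) <= (J%:R + 1) * ln 65.
  apply: (@le_trans _ _ (ln (65 ^ J.+1)%:R)).
    by rewrite ler_ln ?posrE ?ltr0n ?expn_gt0// ler_nat ltnW.
  by rewrite natrX lnXn ?ltr0n// -[leLHS]mulr_natl -natr1.
move=> H1 H2; rewrite mulrC ler_pdivrMr ?mulr_gt0//.
rewrite (le_trans H1)// mulrA ler_wpM2r ?(ltW l65)//; lra.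
Qed.

End Littlewood.

(** * From means to Hardy norms *)

Section Norms.
Variable R : realType.
Variable lam : nat -> R.
Hypothesis lam_freq : is_frequency lam.
Implicit Types (A : {fset nat}) (eps : nat -> R[i]) (p q s c C m : R).

Definition dsum eps A t : R[i] := \sum_(n <- A) eps n * ch (lam n) t.

Lemma modulus_dsum eps A t : modulus_it (one_eps lam eps A) t = nrm (dsum eps A t).
Proof.
congr nrm; apply: eq_bigr => n _; congr (_ * _).
rewrite /cexp /ch /= !mul0r !mulr0 subrr addr0 oppr0 expR0 mul1r.
by rewrite cosN sinN.
Qed.

Lemma lam_inj : injective lam.
Proof.
case: lam_freq => _ linc _ m n mn.
by case: (ltngtP m n) => // /linc; rewrite mn ltxx.
Qed.

Lemma EP_dsum eps A : EP setT (dsum eps A).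
Proof. exact: EP_lincomb. Qed.

Lemma unimodular_nrm eps A : is_unimodular A eps -> forall n, n \in A -> nrm (eps n) = 1.
Proof. by move=> eps1 n /eps1; rewrite normE => -[]. Qed.

Lemma dsum_L2 eps A : is_unimodular A eps ->
  has_mean (fun t => nrm (dsum eps A t) ^+ 2) (#|` A|)%:R.
Proof.
move=> /unimodular_nrm eps1.
apply: mean_eq (parseval eps (fset_uniq A) (in2W lam_inj)) _ _ => //.
rewrite big_seq (eq_bigr (fun=> 1)) => [|n nA]; last by rewrite eps1// expr1n.
by rewrite -big_seq big_const_seq count_predT iter_addr_0.
Qed.

Lemma dsum_le eps A t : is_unimodular A eps -> nrm (dsum eps A t) <= (#|` A|)%:R.
Proof.
move=> /unimodular_nrm eps1.
have : forall s : seq nat, {subset s <= A} ->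
    nrm (\sum_(n <- s) eps n * ch (lam n) t) <= (size s)%:R.
  elim=> [|n s IH] sA; first by rewrite big_nil Normc.normc0.
  rewrite big_cons (le_trans (le_normcD _ _))// Normc.normcM nrm_ch mulr1.
  rewrite eps1 ?sA ?mem_head//= -natr1 addrC lerD2r IH// => k ks.
  by apply: sA; rewrite inE ks orbT.
exact.
Qed.

Lemma cvg_powR_ge0 (g : R -> R) m r : 0 < r -> 0 <= m -> (forall T, 0 < T -> 0 <= g T) ->
  g T @[T --> +oo] --> m -> g T `^ r @[T --> +oo] --> m `^ r.
Proof.
move=> r0; rewrite le_eqVlt => /predU1P[<- g0 gm|m0 g0 gm].
  rewrite powR0 ?gt_eqF//; apply/cvgrPdist_le => e e0.
  have er0 : 0 < e `^ r^-1 by exact: powR_gt0.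
  have /cvgrPdist_le/(_ _ er0) := gm => gm'.
  near=> T; have T0 : 0 < T by near: T; exact: nbhs_pinfty_gt.
  have : `|0 - g T| <= e `^ r^-1 by near: T.
  rewrite !sub0r !normrN !ger0_norm ?powR_ge0 ?g0// => H.
  have -> : e = (e `^ r^-1) `^ r by rewrite -powRrM mulVf ?gt_eqF// powRr1 ?ltW.
  by apply: ge0_ler_powR; rewrite ?nnegrE ?powR_ge0 ?g0 ?(ltW r0).
have cm : {for m, continuous (fun x : R => x `^ r)}.
  apply: differentiable_continuous; apply/derivable1_diffP.
  by apply: derivable_powR; rewrite in_itv/= m0.
exact: (cvg_comp _ _ gm cm).
Unshelve. all: by end_near. Qed.

(** The only analytic point is that the q-th root may be taken inside the
limit. *)
Lemma Hnorm_mean q eps A : 1 <= q -> exists2 m,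
  has_mean (fun t => nrm (dsum eps A t) `^ q) m &
  Hnorm q%:E (one_eps lam eps A) = m `^ q^-1.
Proof.
move=> q1; have [m hm] := mean_nrm_powR (EP_dsum eps A) q1; exists m => //.
have m0 : 0 <= m by apply: mean_ge0 hm _ => t; exact: powR_ge0.
rewrite /Hnorm (_ : (fun t => modulus_it (one_eps lam eps A) t `^ q) =
  (fun t => nrm (dsum eps A t) `^ q)); last first.
  by apply/funext => t; rewrite modulus_dsum.
apply: cvg_lim => //; apply: cvg_powR_ge0 (mean_cvg hm) => //.
  by rewrite invr_gt0; lra.
move=> T T0; apply: mulr_ge0; first by rewrite invr_ge0 mulr_ge0// ltW.
by apply: Rintegral_ge0 => t _; exact: powR_ge0.
Qed.

(** A lower bound for all unimodular coefficients and an upper bound for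
one set with coefficients 1 determine both functions at once, since the infimum over
all coefficients is the smaller of the two. *)
Lemma approx_l (P : \bar R) N0 (h : nat -> R) c C : 0 < c -> 0 < C ->
  (forall M N, (N0 <= M <= N)%N -> h M <= h N) ->
  (forall A eps, is_unimodular A eps -> (N0 <= #|` A|)%N ->
     c * h #|` A| <= Hnorm P (one_eps lam eps A)) ->
  (forall N, (N0 <= N)%N -> exists A, (N <= #|` A|)%N /\
     Hnorm P (one_set lam A) <= C * h N) ->
  approx3_from N0 (phi_l P lam) (phi_lE P lam) h.
Proof.
move=> c0 C0 hinc lower upper.
have unit1 A : is_unimodular A (fun=> 1 : R[i]) by move=> n _; rewrite normr1.
have B1 N : (N0 <= N)%N -> c * h N <= phi_lE P lam N.
  move=> NN; apply: lb_le_inf.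
    have [A [NA _]] := upper N NN.
    by exists (Hnorm P (one_set lam A)), A, (fun=> 1); split.
  move=> _ [A [eps [NA eps1 ->]]]; apply: le_trans (lower A eps eps1 (leq_trans NN NA)).
  by rewrite ler_pM2l// hinc// NN.
have lbE N : (N0 <= N)%N -> has_lbound [set x | exists A eps,
    [/\ (N <= #|` A|)%N, is_unimodular A eps & x = Hnorm P (one_eps lam eps A)]].
  move=> NN; exists (c * h N) => _ [A [eps [NA eps1 ->]]].
  apply: le_trans (lower A eps eps1 (leq_trans NN NA)).
  by rewrite ler_pM2l// hinc// NN.
have B2 N : (N0 <= N)%N -> phi_lE P lam N <= phi_l P lam N.
  move=> NN; have [A0 [NA0 _]] := upper N NN.
  apply: lb_le_inf; first by exists (Hnorm P (one_set lam A0)), A0.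
  move=> _ [A NA <-]; apply: ge_inf; first exact: lbE.
  by exists A, (fun=> 1).
have B3 N : (N0 <= N)%N -> phi_l P lam N <= C * h N.
  move=> NN; have [A [NA leA]] := upper N NN; apply: le_trans leA.
  apply: ge_inf; last by exists A.
  exists (c * h N) => _ [B NB <-].
  apply: le_trans (lower B (fun=> 1) (unit1 B) (leq_trans NN NB)).
  by rewrite ler_pM2l// hinc// NN.
split.
  exists 1, (C / c); split; rewrite ?divr_gt0// => N NN.
  rewrite mul1r B2//= (le_trans (B3 N NN))// -mulrA ler_pM2l//.
  by rewrite mulrC ler_pdivlMr// mulrC B1.
exists c, C; split=> // N NN; rewrite B1//=.
exact: le_trans (B2 N NN) (B3 N NN).
Qed.

(** The dual of [approx_l]: the supremum over all coefficients is the larger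
of the two. *)
Lemma approx_u (P : \bar R) N0 (h : nat -> R) c C : 0 < c -> 0 < C ->
  (forall N A eps, (N0 <= N)%N -> is_unimodular A eps -> (#|` A| <= N)%N ->
     Hnorm P (one_eps lam eps A) <= C * h N) ->
  (forall N, (N0 <= N)%N -> exists A, (#|` A| <= N)%N /\
     c * h N <= Hnorm P (one_set lam A)) ->
  approx3_from N0 (phi_u P lam) (phi_uE P lam) h.
Proof.
move=> c0 C0 upper lower.
have unit1 A : is_unimodular A (fun=> 1 : R[i]) by move=> n _; rewrite normr1.
have B1 N : (N0 <= N)%N -> phi_uE P lam N <= C * h N.
  move=> NN; apply: ge_sup.
    have [A [NA _]] := lower N NN.
    by exists (Hnorm P (one_set lam A)), A, (fun=> 1); split.
  by move=> _ [A [eps [NA eps1 ->]]]; exact: upper.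
have ubE N : (N0 <= N)%N -> has_ubound [set x | exists A eps,
    [/\ (#|` A| <= N)%N, is_unimodular A eps & x = Hnorm P (one_eps lam eps A)]].
  by move=> NN; exists (C * h N) => _ [A [eps [NA eps1 ->]]]; exact: upper.
have B2 N : (N0 <= N)%N -> phi_u P lam N <= phi_uE P lam N.
  move=> NN; have [A0 [NA0 _]] := lower N NN.
  apply: ge_sup; first by exists (Hnorm P (one_set lam A0)), A0.
  move=> _ [A NA <-]; apply: ub_le_sup; first exact: ubE.
  by exists A, (fun=> 1).
have B3 N : (N0 <= N)%N -> c * h N <= phi_u P lam N.
  move=> NN; have [A [NA leA]] := lower N NN; apply: (le_trans leA).
  apply: ub_le_sup; last by exists A.
  by exists (C * h N) => _ [B NB <-]; exact: upper.
split.
  exists (c / C), 1; split; rewrite ?divr_gt0// => N NN.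
  rewrite mul1r B2// andbT (le_trans _ (B3 N NN))// -mulrA ler_pM2l//.
  by rewrite mulrC ler_pdivrMr// mulrC B1.
exists c, C; split=> // N NN; rewrite B1// andbT.
exact: le_trans (B3 N NN) (B2 N NN).
Qed.

End Norms.

(** * Bounds for means by interpolation *)

Section MeanBounds.
Variable R : realType.
Implicit Types (F : R -> R[i]) (p q r s x n N m a c C : R).

Section Given.
Variables (F : R -> R[i]) (n N : R).
Hypothesis N0 : 0 < N.
Hypothesis hF : has_mean (fun t => nrm (F t) ^+ 2) n.

Let sN := N `^ 2^-1.
Let sN0 : 0 < sN. Proof. exact: powR_gt0. Qed.
Let sNE a : sN `^ a = N `^ (a / 2).
Proof. by rewrite /sN -powRrM mulrC. Qed.

Let hF2 : has_mean (fun t => nrm (F t) `^ 2) n.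
Proof. by apply: mean_eq hF _ _ => // t; rewrite powR_mulrn// nrm_ge0. Qed.

Lemma mean_lower_trivial p m : n = N -> (forall t, nrm (F t) <= N) -> 1 <= p <= 2 ->
  has_mean (fun t => nrm (F t) `^ p) m -> N `^ (p - 1) <= m.
Proof.
move=> nN FN /andP[p1 p2] hm.
have : n <= N `^ (2 - p) * m.
  apply: le_mean hF2 (meanZ _ hm) _ => t; apply: powR_split => //; rewrite ?nrm_ge0//; lra.
rewrite nN => H.
rewrite -(ler_pM2l (powR_gt0 (2 - p) N0)) powR_mul//.
by have -> : 2 - p + (p - 1) = 1 by [ring]; rewrite powRr1// ltW.
Qed.

(** The bound N and the mean square n are kept apart because the
set may have fewer than N elements. *)
Lemma mean_upper_trivial p m : n <= N -> (forall t, nrm (F t) <= N) -> 2 <= p ->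
  has_mean (fun t => nrm (F t) `^ p) m -> m <= N `^ (p - 1).
Proof.
move=> nN FN p2 hm.
have : m <= N `^ (p - 2) * n.
  by apply: le_mean hm (meanZ _ hF2) _ => t; apply: powR_split; rewrite ?nrm_ge0.
move=> /le_trans; apply.
have -> : p - 1 = p - 2 + 1 by ring.
by rewrite -(powR_mul (p - 2) 1 N0) powRr1 ?(ltW N0)// ler_wpM2l ?powR_ge0.
Qed.

Lemma mean_upper_L2 p m : n <= N -> 1 <= p <= 2 ->
  has_mean (fun t => nrm (F t) `^ p) m -> m <= 2 * N `^ (p / 2).
Proof.
move=> nN /andP[p1 p2] hm.
have : m <= sN `^ p + sN `^ (p - 2) * n.
  apply: le_mean hm (meanD (mean_cst _) (meanZ _ hF2)) _ => t.
  apply: powR_interp0; rewrite ?nrm_ge0//; lra.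
move=> /le_trans; apply; rewrite !sNE.
have : N `^ ((p - 2) / 2) * n <= N `^ (p / 2).
  have -> : p / 2 = (p - 2) / 2 + 1 by field.
  by rewrite -[leRHS](powR_mul ((p - 2) / 2) 1 N0) powRr1 ?(ltW N0)// ler_wpM2l ?powR_ge0.
lra.
Qed.

Lemma mean_lower_L2 p m : n = N -> 2 <= p ->
  has_mean (fun t => nrm (F t) `^ p) m -> 2^-1 `^ (p / 2) * N `^ (p / 2) <= m.
Proof.
move=> nN p2 hm; pose s := (2^-1 * N) `^ 2^-1.
have h0 : 0 < 2^-1 * N by rewrite mulr_gt0.
have sE b : s `^ b = (2^-1 * N) `^ (b / 2) by rewrite /s -powRrM (mulrC _ b).
have : n <= s `^ 2 + s `^ (2 - p) * m.
  apply: le_mean hF2 (meanD (mean_cst _) (meanZ _ hm)) _ => t.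
  by apply: powR_interp0; rewrite ?powR_gt0 ?nrm_ge0.
rewrite nN !sE divff// powRr1 ?(ltW h0)// => H.
rewrite -powRM ?(ltW N0)//.
rewrite -(ler_pM2l (powR_gt0 ((2 - p) / 2) h0)) powR_mul//.
have -> : (2 - p) / 2 + p / 2 = 1 by field.
rewrite powRr1 ?(ltW h0)//; lra.
Qed.

Lemma mean_upper_sparse p (j : nat) m a : p <= (2 * j)%:R -> 2 <= p ->
  has_mean (fun t => nrm (F t ^+ j) ^+ 2) a -> a <= (j`!)%:R * N ^+ j ->
  has_mean (fun t => nrm (F t) `^ p) m -> m <= (1 + (j`!)%:R) * N `^ (p / 2).
Proof.
move=> pj p2 ha aN hm.
have ha' : has_mean (fun t => nrm (F t) `^ (2 * j)%:R) a.
  apply: mean_eq ha _ _ => // t.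
  by rewrite powR_mulrn ?nrm_ge0// nrmX -exprM mulnC.
have : m <= sN `^ p + sN `^ (p - (2 * j)%:R) * a.
  apply: le_mean hm (meanD (mean_cst _) (meanZ _ ha')) _ => t.
  apply: powR_interp0; rewrite ?nrm_ge0//; lra.
move=> /le_trans; apply; rewrite !sNE [leRHS]mulrDl mul1r lerD2l.
have : N `^ ((p - (2 * j)%:R) / 2) * a <= N `^ ((p - (2 * j)%:R) / 2) * ((j`!)%:R * N ^+ j).
  by rewrite ler_wpM2l ?powR_ge0.
move=> /le_trans; apply; rewrite mulrCA -powR_mulrn ?(ltW N0)// powR_mul//.
by rewrite natrM (_ : (p - 2 * j%:R) / 2 + j%:R = p / 2)//; field.
Qed.

Lemma mean_lower_sparse p m a : n = N -> 1 <= p <= 2 ->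
  has_mean (fun t => nrm (F t ^+ 2) ^+ 2) a -> a <= 2 * N ^+ 2 ->
  has_mean (fun t => nrm (F t) `^ p) m -> 4 `^ ((p - 2) / 2) / 2 * N `^ (p / 2) <= m.
Proof.
move=> nN /andP[p1 p2] ha aN hm; pose s := (4 * N) `^ 2^-1.
have h0 : 0 < 4 * N by rewrite mulr_gt0.
have sE b : s `^ b = (4 * N) `^ (b / 2) by rewrite /s -powRrM (mulrC _ b).
have ha' : has_mean (fun t => nrm (F t) `^ 4%:R) a.
  by apply: mean_eq ha _ _ => // t; rewrite powR_mulrn ?nrm_ge0// nrmX -exprM.
have : n <= s `^ (2 - p) * m + s `^ (2 - 4%:R) * a.
  apply: le_mean hF2 (meanD (meanZ _ hm) (meanZ _ ha')) _ => t.
  by apply: powR_interp; rewrite ?powR_gt0 ?nrm_ge0//; lra.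
rewrite nN !sE => H.
have E : (4 * N) `^ ((2 - 4%:R) / 2) = (4 * N)^-1.
  have -> : (2 - 4%:R) / 2 = - 1 :> R by lra.
  by rewrite powR_inv1// ltW.
have : (4 * N)^-1 * a <= N / 2.
  have -> : N / 2 = (4 * N)^-1 * (2 * N ^+ 2) by field; exact: lt0r_neq0.
  by rewrite ler_wpM2l// invr_ge0 ltW.
rewrite -E => H2.
have H3 : N / 2 <= (4 * N) `^ ((2 - p) / 2) * m by lra.
have -> : 4 `^ ((p - 2) / 2) / 2 * N `^ (p / 2) = (4 * N) `^ ((p - 2) / 2) * (N / 2).
  have -> : p / 2 = (p - 2) / 2 + 1 by field.
  rewrite -(powR_mul ((p - 2) / 2) 1 N0) powRr1 ?(ltW N0)// powRM ?(ltW N0)//; ring.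
rewrite -(ler_pM2l (powR_gt0 ((2 - p) / 2) h0)) (mulrA (_ `^ _) (_ `^ _)) powR_mul//.
have -> : (2 - p) / 2 + (p - 2) / 2 = 0 by field.
by rewrite powRr0 mul1r.
Qed.

End Given.
End MeanBounds.

(** * Growth of the democracy functions *)

Section Democracy.
Variable R : realType.
Variable lam : nat -> R.
Hypothesis lam_freq : is_frequency lam.
Hypothesis lam_AP : has_large_APs lam.
Implicit Types (A : {fset nat}) (eps : nat -> R[i]) (p q s c C m : R).

Lemma unimodular1 A : is_unimodular A (fun=> 1 : R[i]).
Proof. by move=> n _; rewrite normr1. Qed.

Lemma root_le q s C (N m : R) : 1 <= q -> 0 <= C -> 0 <= N -> 0 <= m ->
  m <= C * N `^ s -> m `^ q^-1 <= C `^ q^-1 * N `^ (s / q).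
Proof.
move=> q1 C0 N0 m0 mC; rewrite powRrM -powRM ?powR_ge0//.
apply: ge0_ler_powR; rewrite ?nnegrE ?mulr_ge0 ?powR_ge0//.
rewrite invr_ge0; lra.
Qed.

Lemma root_ge q s c (N m : R) : 1 <= q -> 0 <= c -> 0 <= N -> 
  c * N `^ s <= m -> c `^ q^-1 * N `^ (s / q) <= m `^ q^-1.
Proof.
move=> q1 c0 N0 cm; rewrite powRrM -powRM ?powR_ge0//.
have cN : 0 <= c * N `^ s by rewrite mulr_ge0 ?powR_ge0.
apply: ge0_ler_powR; rewrite ?nnegrE//; last exact: le_trans cm.
rewrite invr_ge0; lra.
Qed.

Lemma mean_powR_ge0 eps A q m :
  has_mean (fun t => nrm (dsum lam eps A t) `^ q) m -> 0 <= m.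
Proof. by move/mean_ge0; apply => t; exact: powR_ge0. Qed.

Lemma approx_l_pow q s c C : 1 <= q -> 0 <= s -> 0 < c -> 0 < C ->
  (forall A eps m, is_unimodular A eps -> (1 <= #|` A|)%N ->
     has_mean (fun t => nrm (dsum lam eps A t) `^ q) m ->
     c * (#|` A|)%:R `^ s <= m) ->
  (forall N, (1 <= N)%N -> exists A, (N <= #|` A|)%N /\ forall m,
     has_mean (fun t => nrm (dsum lam (fun=> 1) A t) `^ q) m -> m <= C * N%:R `^ s) ->
  approx3_from 1 (phi_l q%:E lam) (phi_lE q%:E lam) (fun N => N%:R `^ (s / q)).
Proof.
move=> q1 s0 c0 C0 lower upper; have q0 : 0 < q by lra.
apply: (approx_l (c := c `^ q^-1) (C := C `^ q^-1)); rewrite ?powR_gt0//.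
- move=> M N /andP[_ MN]; apply: ge0_ler_powR; rewrite ?nnegrE ?ler_nat//.
  by rewrite divr_ge0// ltW.
- move=> A eps eps1 A1; have [m hm ->] := Hnorm_mean lam eps A q1.
  by apply: root_ge => //; [exact: ltW|exact: lower hm].
- move=> N N1; have [A [NA HA]] := upper N N1; exists A; split=> //.
  have [m hm ->] := Hnorm_mean lam (fun=> 1) A q1.
  by apply: root_le => //; [exact: ltW|exact: mean_powR_ge0 hm|exact: HA].
Qed.

Lemma approx_u_pow q s c C : 1 <= q -> 0 <= s -> 0 < c -> 0 < C ->
  (forall N A eps m, (1 <= N)%N -> is_unimodular A eps -> (#|` A| <= N)%N ->
     has_mean (fun t => nrm (dsum lam eps A t) `^ q) m ->
     m <= C * N%:R `^ s) ->
  (forall N, (1 <= N)%N -> exists A, (#|` A| <= N)%N /\ forall m,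
     has_mean (fun t => nrm (dsum lam (fun=> 1) A t) `^ q) m -> c * N%:R `^ s <= m) ->
  approx3_from 1 (phi_u q%:E lam) (phi_uE q%:E lam) (fun N => N%:R `^ (s / q)).
Proof.
move=> q1 s0 c0 C0 upper lower; have q0 : 0 < q by lra.
apply: (approx_u (c := c `^ q^-1) (C := C `^ q^-1)); rewrite ?powR_gt0//.
- move=> N A eps N1 eps1 AN; have [m hm ->] := Hnorm_mean lam eps A q1.
  by apply: root_le => //; [exact: ltW|exact: mean_powR_ge0 hm|exact: upper hm].
- move=> N N1; have [A [NA HA]] := lower N N1; exists A; split=> //.
  have [m hm ->] := Hnorm_mean lam (fun=> 1) A q1.
  by apply: root_ge => //; [exact: ltW|exact: HA].
Qed.

Lemma progression_mean N : exists A, #|` A| = N /\ forall q m,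
  has_mean (fun t => nrm (dsum lam (fun=> 1) A t) `^ q) m ->
  1 <= q -> has_mean (fun t => nrm (geo N (ch 1 t)) `^ q) m.
Proof.
have [A [nu [w [b [AN b0 AE _]]]]] := progression_sets N lam_freq lam_AP.
exists A; split; first exact: AN.
move=> q m hm q1.
have [m' hm'] := mean_nrm_powR (EP_geo R N) q1.
suff hA : has_mean (fun t => nrm (dsum lam (fun=> 1) A t) `^ q) m'.
  by rewrite (mean_unique hm hA).
apply: mean_eq (mean_affine 0 (lt0r_neq0 b0) hm') _ erefl => t.
rewrite /dsum AE Normc.normcM nrm_ch mul1r addr0; congr (nrm _ `^ q).
by apply: eq_bigr => k _; rewrite mul1r.
Qed.

(** The dyadic sizes for which the kernel is estimated suffice, up to a
factor 2. *)
Lemma pow2_above N : (1 <= N)%N -> exists k : nat, (N <= 2 ^ k < 2 * N)%N.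
Proof.
move=> N1; exists (up_log 2 N); apply/andP; split; first exact: up_logP.
have [->|N2] : N = 1%N \/ (1 < N)%N by case: N N1 => [|[|]]; auto.
  by rewrite up_log1.
have := up_log_bounds (ltnSn 1) N2; case: (up_log 2 N) => [|m] /andP[lt _]; first by rewrite expn0 (leq_trans N2)// leq_pmull.
by rewrite expnS ltn_pmul2l.
Qed.

Lemma pow2_below N : (1 <= N)%N -> exists k : nat, (2 ^ k <= N < 2 * 2 ^ k)%N.
Proof.
move=> N1; exists (trunc_log 2 N); rewrite -expnS.
by rewrite trunc_logP//= trunc_log_ltn.
Qed.

Lemma democracy_l_small p : 1 < p <= 2 ->
  approx3_from 1 (phi_l p%:E lam) (phi_lE p%:E lam) (fun N => N%:R `^ ((p - 1) / p)).
Proof.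
move=> /andP[p1 p2]; have [C C0 HC] := kernel_Lp_upper p1.
apply: (@approx_l_pow _ _ 1 (C * 2 `^ (p - 1))); rewrite ?mulr_gt0 ?powR_gt0//; try lra.
- move=> A eps m eps1 A1 hm; rewrite mul1r.
  have A0 : 0 < (#|` A|)%:R :> R by rewrite ltr0n.
  apply: (mean_lower_trivial A0 (dsum_L2 lam_freq eps1) erefl _ _ hm); last lra.
  by move=> t; exact: dsum_le.
- move=> N /pow2_above[k /andP[Nk kN]].
  have [A [AN HA]] := progression_mean (2 ^ k); exists A; split; first by rewrite AN.
  move=> m /HA/(_ (ltW p1))/HC/le_trans; apply.
  rewrite -mulrA ler_pM2l// -powRM//.
  apply: ge0_ler_powR; rewrite ?nnegrE ?mulr_ge0 ?subr_ge0 ?(ltW p1)//.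
  by rewrite -natrM ler_nat ltnW.
Qed.

Lemma democracy_u_large p : 2 <= p ->
  approx3_from 1 (phi_u p%:E lam) (phi_uE p%:E lam) (fun N => N%:R `^ ((p - 1) / p)).
Proof.
move=> p2; have [c c0 Hc] := kernel_Lp_lower p2.
apply: (@approx_u_pow _ _ (c * 2^-1 `^ (p - 1)) 1); rewrite ?mulr_gt0 ?powR_gt0//; try lra.
- move=> N A eps m N1 eps1 AN hm; rewrite mul1r.
  have N0 : 0 < N%:R :> R by rewrite ltr0n.
  have AN' : (#|` A|)%:R <= N%:R :> R by rewrite ler_nat.
  apply: (mean_upper_trivial N0 (dsum_L2 lam_freq eps1) AN' _ p2 hm).
  by move=> t; exact: le_trans (dsum_le lam t eps1) AN'.
- move=> N /pow2_below[k /andP[kN Nk]].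
  have [A [AN HA]] := progression_mean (2 ^ k); exists A; split; first by rewrite AN.
  move=> m /HA/(_ (le_trans (ler1n _ 2) p2))/Hc; apply: le_trans.
  rewrite -mulrA ler_pM2l// -powRM//.
  apply: ge0_ler_powR; rewrite ?nnegrE ?mulr_ge0//; first lra.
  by rewrite mulrC ler_pdivrMr// -natrM ler_nat mulnC ltnW.
Qed.

Lemma sparse_mean M N : exists A, #|` A| = N /\ forall j, (j <= M)%N -> exists2 a,
    has_mean (fun t => nrm (dsum lam (fun=> 1) A t ^+ j) ^+ 2) a &
    a <= (j`!)%:R * N%:R ^+ j.
Proof.
have [A [AN HA]] := sparse_sets M N lam_freq; exists A; split; first exact: AN.
move=> j /HA[a ha aN]; exists a; last exact: aN.
apply: mean_eq ha _ erefl => t; congr (nrm (_ ^+ j) ^+ 2).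
by apply: eq_bigr => n _; rewrite mul1r.
Qed.

Lemma democracy_l_large p : 2 <= p ->
  approx3_from 1 (phi_l p%:E lam) (phi_lE p%:E lam) (fun N => N%:R `^ 2^-1).
Proof.
move=> p2; pose j := (Num.truncn p).+1.
have pj : p <= (2 * j)%:R.
  by rewrite (le_trans (ltW (truncnS_gt p)))// ler_nat leq_pmull.
have -> : 2^-1 = p / 2 / p by field; lra.
apply: (@approx_l_pow _ _ (2^-1 `^ (p / 2)) (1 + (j`!)%:R)); rewrite ?powR_gt0 ?divr_ge0 ?ltr_wpDr//; try lra.
- move=> A eps m eps1 A1 hm.
  have A0 : 0 < (#|` A|)%:R :> R by rewrite ltr0n.
  exact: (mean_lower_L2 A0 (dsum_L2 lam_freq eps1) erefl p2 hm).
- move=> N N1; have [A [AN HA]] := sparse_mean j N; exists A; split; first by rewrite AN.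
  have [a ha aN] := HA j (leqnn _); move=> m hm.
  have N0 : 0 < N%:R :> R by rewrite ltr0n.
  exact: (mean_upper_sparse N0 pj p2 ha aN hm).
Qed.

Lemma democracy_u_small p : 1 <= p <= 2 ->
  approx3_from 1 (phi_u p%:E lam) (phi_uE p%:E lam) (fun N => N%:R `^ 2^-1).
Proof.
move=> p12; have /andP[p1 p2] := p12.
have -> : 2^-1 = p / 2 / p by field; lra.
apply: (@approx_u_pow _ _ (4 `^ ((p - 2) / 2) / 2) 2); rewrite ?divr_gt0 ?powR_gt0//; try lra.
- move=> N A eps m N1 eps1 AN hm.
  have N0 : 0 < N%:R :> R by rewrite ltr0n.
  have AN' : (#|` A|)%:R <= N%:R :> R by rewrite ler_nat.
  exact: (mean_upper_L2 N0 (dsum_L2 lam_freq eps1) AN' p12 hm).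
- move=> N N1; have [A [AN HA]] := sparse_mean 2 N; exists A; split; first by rewrite AN.
  have [a ha aN] := HA 2 (leqnn _); move=> m hm.
  have N0 : 0 < N%:R :> R by rewrite ltr0n.
  have AN' : (#|` A|)%:R = N%:R :> R by rewrite AN.
  exact: (mean_lower_sparse N0 (dsum_L2 lam_freq (@unimodular1 A)) AN' p12 ha aN hm).
Qed.

Lemma democracy_l_1 :
  approx3_from 2 (phi_l 1%:E lam) (phi_lE 1%:E lam) (fun N => ln N%:R).
Proof.
have [c c0 Hc] := littlewood R.
have l2 : 0 < ln 2 :> R by rewrite ln_gt0// ltr1n.
apply: (approx_l (c := c) (C := 3 / ln 2)) => //; first by rewrite divr_gt0.
- move=> M N /andP[M2 MN].
  by rewrite ler_ln ?posrE ?ltr0n ?ler_nat ?(leq_trans _ M2) ?(leq_trans _ MN) ?(ltnW M2).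
- move=> A eps eps1 A2; have [m hm ->] := Hnorm_mean lam eps A (lexx 1).
  rewrite invr1 powRr1; last exact: mean_powR_ge0 hm.
  (* the inequality is about sums in increasing order of the frequencies *)
  pose s := sort leq A.
  have ss : size s = #|` A| by rewrite size_sort.
  apply: (Hc (fun k => lam (nth 0%N s k)) (fun k => eps (nth 0%N s k))).
  + move=> k l /andP[kl lA]; have [_ linc _] := lam_freq; apply: linc.
    have st : sorted ltn s by rewrite ltn_sorted_uniq_leq sort_uniq fset_uniq sort_sorted//; exact: leq_total.
    by apply: (sorted_ltn_nth ltn_trans 0%N st) => //; rewrite inE ss// (ltn_trans kl).
  + move=> k kA; apply: (unimodular_nrm eps1).
    by rewrite -(mem_sort leq) mem_nth// ss.
  + exact: leq_trans A2.
  + apply: mean_eq hm _ _ => // t; congr (nrm _ `^ 1).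
    rewrite /dsum /psum -ss -(big_mkord xpredT (fun k => eps (nth 0%N s k) * ch (lam (nth 0%N s k)) t)).
    by rewrite -(big_nth 0%N xpredT (fun n => eps n * ch (lam n) t)) (perm_big s)//= perm_sym perm_sort.
- move=> N N2; have [k /andP[Nk kN]] := pow2_above (ltnW N2).
  have [A [AN HA]] := progression_mean (2 ^ k); exists A; split; first by rewrite AN.
  have [m hm ->] := Hnorm_mean lam (fun=> 1) A (lexx 1).
  rewrite invr1 powRr1; last exact: mean_powR_ge0 hm.
  have := kernel_L1 (HA 1 m hm (lexx 1)) => /le_trans; apply.
  have N0 : (0 < N)%N by exact: ltnW.
  have H1 : k%:R * ln 2 <= ln 2 + ln N%:R :> R.
    rewrite -lnM ?posrE ?ltr0n// -natrM mulr_natl -lnXn// -natrX.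
    by rewrite ler_ln ?posrE ?ltr0n ?muln_gt0 ?expn_gt0// ler_nat ltnW.
  have H2 : ln 2 <= ln N%:R :> R by rewrite ler_ln ?posrE ?ltr0n// ler_nat.
  by rewrite mulrAC ler_pdivlMr//; lra.
Qed.

Lemma Hnorm_inf_ge eps A t : is_unimodular A eps ->
  nrm (dsum lam eps A t) <= Hnorm +oo%E (one_eps lam eps A).
Proof.
move=> eps1; apply: ub_le_sup; last by exists t => //; exact: modulus_dsum.
by exists (#|` A|)%:R => _ [u _ <-]; rewrite modulus_dsum; exact: dsum_le.
Qed.

Lemma Hnorm_inf_le eps A C : (forall t, nrm (dsum lam eps A t) <= C) ->
  Hnorm +oo%E (one_eps lam eps A) <= C.
Proof.
move=> AC'; apply: ge_sup; first by exists (modulus_it (one_eps lam eps A) 0), 0.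
by move=> _ [u _ <-]; rewrite modulus_dsum.
Qed.

Lemma Hnorm_inf_one A : Hnorm +oo%E (one_set lam A) = (#|` A|)%:R.
Proof.
apply/le_anti/andP; split.
  by apply: Hnorm_inf_le => t; exact: dsum_le (@unimodular1 A).
rewrite (le_trans _ (Hnorm_inf_ge 0 (@unimodular1 A)))//.
rewrite /dsum (eq_bigr (fun=> 1)) => [|n _]; last first.
  by rewrite mul1r /ch mulr0 cos0 sin0 oppr0.
rewrite big_const_seq count_predT iter_addr_0 normcMn Normc.normc1.
by [].
Qed.

Lemma card_exists N : exists A : {fset nat}, #|` A| = N.
Proof. by have [A [AN _]] := progression_mean N; exists A. Qed.

Lemma democracy_l_inf N : phi_l +oo%E lam N = N%:R.
Proof.
have [A AN] := card_exists N; apply/le_anti/andP; split.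
  apply: ge_inf; last by exists A; [rewrite /= AN|rewrite Hnorm_inf_one AN].
  by exists 0 => _ [B _ <-]; rewrite Hnorm_inf_one.
apply: lb_le_inf; first by exists (Hnorm +oo%E (one_set lam A)), A; rewrite /= ?AN.
by move=> _ [B NB <-]; rewrite Hnorm_inf_one ler_nat.
Qed.

Lemma democracy_u_inf N : phi_u +oo%E lam N = N%:R.
Proof.
have [A AN] := card_exists N; apply/le_anti/andP; split.
  apply: ge_sup; first by exists (Hnorm +oo%E (one_set lam A)), A; rewrite /= ?AN.
  by move=> _ [B NB <-]; rewrite Hnorm_inf_one ler_nat.
apply: ub_le_sup; last by exists A; [rewrite /= AN|rewrite Hnorm_inf_one AN].
by exists N%:R => _ [B BN <-]; rewrite Hnorm_inf_one ler_nat.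
Qed.

Lemma democracy_uE_inf N : phi_uE +oo%E lam N = N%:R.
Proof.
have [A AN] := card_exists N.
have U : forall x : R, (exists B eps, [/\ (#|` B| <= N)%N, is_unimodular B eps &
    x = Hnorm +oo%E (one_eps lam eps B)]) -> x <= N%:R.
  move=> _ [B [eps [BN eps1 ->]]]; apply: Hnorm_inf_le => t.
  by rewrite (le_trans (dsum_le lam t eps1))// ler_nat.
have I : exists B eps, [/\ (#|` B| <= N)%N, is_unimodular B eps &
    N%:R = Hnorm +oo%E (one_eps lam eps B)].
  by exists A, (fun=> 1); split; rewrite ?AN//; [exact: unimodular1|rewrite -AN -Hnorm_inf_one].
apply/le_anti/andP; split; first by apply: ge_sup => //; exists N%:R.
by apply: ub_le_sup => //; exists N%:R.
Qed.

(** The sup norm is at least the L^2 norm; Rudin-Shapiro coefficients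
along a progression reverse this up to a constant. *)
Lemma democracy_lE_inf : approx_from 1 (phi_lE +oo%E lam) (fun N => N%:R `^ 2^-1).
Proof.
have lower A eps : is_unimodular A eps ->
    (#|` A|)%:R `^ 2^-1 <= Hnorm +oo%E (one_eps lam eps A).
  move=> eps1; set H := Hnorm _ _.
  have H0 : 0 <= H by apply: le_trans (nrm_ge0 _) (Hnorm_inf_ge 0 eps1).
  rewrite powR12_sqrt// -(ger0_norm H0) -sqrtr_sqr ler_sqrt ?sqr_ge0//.
  apply: le_mean (dsum_L2 lam_freq eps1) (mean_cst _) _ => t.
  by rewrite ler_pXn2r ?nnegrE ?nrm_ge0//; exact: Hnorm_inf_ge.
exists 1, 2; split=> // N N1; rewrite mul1r.
have [k /andP[Nk kN]] := pow2_above N1.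
have [A [nu [w [b [AN b0 AE Heps]]]]] := progression_sets (2 ^ k) lam_freq lam_AP.
have [r [r1 rS]] := rudin_shapiro R k.
have [eps [epsr epsE]] := Heps r.
have eps1 : is_unimodular A eps.
  by move=> n /epsr[l ->]; rewrite normE r1.
have bound : Hnorm +oo%E (one_eps lam eps A) <= 2 * N%:R `^ 2^-1.
  apply: Hnorm_inf_le => t; rewrite powR12_sqrt//.
  rewrite -(@ler_pXn2r _ 2) ?nnegrE ?nrm_ge0 ?mulr_ge0 ?sqrtr_ge0//.
  rewrite exprMn sqr_sqrtr// /dsum AE Normc.normcM nrm_ch mul1r.
  rewrite (eq_bigr (fun l : 'I__ => r l * ch 1 (b * t) ^+ l)) => [|l _]; last by rewrite epsE.
  rewrite (le_trans (rS _ (nrm_ch _ _)))//.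
  rewrite (_ : 2 ^+ 2 * N%:R = 2 * (2 * N)%:R); last by rewrite natrM; ring.
  by rewrite ler_pM2l// ler_nat ltnW.
have NA : (N <= #|` A|)%N by rewrite AN.
apply/andP; split; last first.
  apply: le_trans bound; apply: ge_inf; last by exists A, eps.
  by exists 0 => _ [B [e [_ e1 ->]]]; apply: le_trans (lower B e e1); exact: powR_ge0.
apply: lb_le_inf; first by exists (Hnorm +oo%E (one_eps lam eps A)), A, eps.
move=> _ [B [e [NB e1 ->]]]; apply: le_trans (lower B e e1).
by apply: ge0_ler_powR; rewrite ?nnegrE ?ler_nat// invr_ge0.
Qed.

End Democracy.

Theorem proposition3p4 (R : realType) (lam : nat -> R)
    (lam_freq : is_frequency lam) (lam_AP : has_large_APs lam) :
  (* (a) *)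
  [/\ approx3_from 2 (phi_l 1%:E lam) (phi_lE 1%:E lam)
        (fun N => ln N%:R),
      (forall p p' : R, 1 < p <= 2 -> p^-1 + p'^-1 = 1 ->
        approx3_from 1 (phi_l p%:E lam) (phi_lE p%:E lam)
          (fun N => N%:R `^ p'^-1))
    & approx_from 1 (phi_lE +oo%E lam) (fun N => N%:R `^ 2^-1)]
  /\
  (* (b) *)
  (forall p p' : R, 2 <= p -> p^-1 + p'^-1 = 1 ->
    approx3_from 1 (phi_u p%:E lam) (phi_uE p%:E lam)
      (fun N => N%:R `^ p'^-1))
  /\
  (* consequence, p = 1 *)
  (approx3_from 2 (phi_l 1%:E lam) (phi_lE 1%:E lam) (fun N => ln N%:R) /\
   approx3_from 1 (phi_u 1%:E lam) (phi_uE 1%:E lam)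
     (fun N => N%:R `^ 2^-1))
  /\
  (* consequence, 1 < p < +oo *)
  (forall p p' : R, 1 < p -> p^-1 + p'^-1 = 1 ->
    approx3_from 1 (phi_l p%:E lam) (phi_lE p%:E lam)
      (fun N => N%:R `^ Num.min 2^-1 p'^-1) /\
    approx3_from 1 (phi_u p%:E lam) (phi_uE p%:E lam)
      (fun N => N%:R `^ Num.max 2^-1 p'^-1))
  /\
  (* consequence, p = +oo *)
  [/\ forall N : nat, (1 <= N)%N -> phi_l +oo%E lam N = N%:R,
      approx_from 1 (phi_lE +oo%E lam) (fun N => N%:R `^ 2^-1)
    & forall N : nat, (1 <= N)%N ->
        phi_u +oo%E lam N = phi_uE +oo%E lam N /\
        phi_uE +oo%E lam N = N%:R].
Proof.
have conj (p p' : R) : 1 < p -> p^-1 + p'^-1 = 1 -> p'^-1 = (p - 1) / p.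
  move=> p1 pp; have -> : (p - 1) / p = 1 - p^-1 by field; lra.
  lra.
have l1 := democracy_l_1 lam_freq lam_AP.
have li := democracy_lE_inf lam_freq lam_AP.
split.
  split=> // p p' p12 pp; have /andP[p1 p2] := p12.
  by rewrite (conj p p')//; exact: democracy_l_small.
split.
  move=> p p' p2 pp; have p1 : 1 < p by lra.
  by rewrite (conj p p')//; exact: democracy_u_large.
split.
  by split=> //; apply: democracy_u_small => //; lra.
split.
  move=> p p' p1 pp; rewrite (conj p p')//.
  have p0 : 0 < p by lra.
  have [p2|/ltW p2] := leP p 2.
    have le2 : (p - 1) / p <= 2^-1 by rewrite ler_pdivrMr//; lra.
    rewrite (min_idPr le2) (max_idPl le2); split.
      by apply: democracy_l_small => //; rewrite p1.
    by apply: democracy_u_small => //; rewrite p2 ltW.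
  have le2 : 2^-1 <= (p - 1) / p by rewrite ler_pdivlMr//; lra.
  rewrite (min_idPl le2) (max_idPr le2); split.
    exact: democracy_l_large.
  exact: democracy_u_large.
split=> // N _; first exact: democracy_l_inf.
by rewrite democracy_u_inf// democracy_uE_inf.
Qed.
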